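(* For each $n\in\mathbb{N}$, there are exactly $$\mathcal{P}(n)=\sum_{d\mid n}\mu(d)\,\mathcal{O}(n/d)$$ primitive classes of periodic orbits of period $2n$ on an equilateral triangle, where $\mu$ is the Möbius function and $\mathcal{O}(m)=\left\lfloor\frac{m+2}{2}\right\rfloor-\left\lfloor\frac{m+2}{3}\right\rfloor$ is the number of equivalence classes of periodic orbits of period $2m$.
   Context: Billiards. Let $R$ be the closed region bounded by the equilateral triangle $\triangle ABC$. A nonsingular trajectory is a piecewise linear constant (nonzero) speed curve $\alpha:\mathbb{R}\to R$, moving in straight lines between successive strikes on the sides, reflecting at each strike so that the angle of incidence equals the angle of reflection, and never reaching a vertex. It is periodic if $\alpha(a+t)=\alpha(b+t)$ for some $a<b$ and all $t$; its restriction to $[a,b]$ is a periodic orbit. A periodic orbit retraces the same path exactly $n\ge1$ times; if $n=1$ it is primitive, otherwise it is an $n$-fold iterate. If $\alpha$ is primitive, $\alpha^n$ is its $n$-fold iterate. The period is the number of strikes on the sides during the orbit (coinciding initial and final positions counted once). The Fagnano orbit $\gamma$ is the primitive orbit of period 3 traversing the triangle whose vertices are the midpoints of the sides. The angle of incidence at a strike is the (non-obtuse) angle between the path and the side struck. Unfoldings. Place $\triangle ABC$ with $\overline{BC}$ horizontal at the bottom, as a tile of a regular tessellation $\mathcal{T}$ of the plane by congruent equilateral triangles having one family of horizontal edges. Let $\alpha$ be a periodic orbit of period $m$. Every such orbit strikes a side at some point $P$ with angle of incidence in $[30^\circ,60^\circ]$; after relabelling vertices, changing the initial point and reversing the parameter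 if necessary, assume $P\in\overline{BC}$, $\alpha$ begins and ends at $P$, and both (Cartesian) components of the velocity on departure from $P$ are positive. Let $\alpha_1,\dots,\alpha_m$ be the successive directed segments of $\alpha$. Reflecting the triangle successively in the edges of $\mathcal{T}$ that the path meets, with reflections $\sigma_1,\dots,\sigma_{m-1}$ ($\sigma_1$ in the edge where $\alpha_1$ ends, $\sigma_2$ in the edge where $\sigma_1(\alpha_2)$ ends, etc.), the segments $\alpha_1,\sigma_1(\alpha_2),\dots,(\sigma_{m-1}\cdots\sigma_1)(\alpha_m)$ are collinear and their union is a directed segment $\underline{PQ}$ from $P$ to $Q=(\sigma_{m-1}\cdots\sigma_1)(P)$. Any directed segment so obtained is called an unfolding of $\alpha$. Equivalence. Periodic orbits $\alpha,\beta$ are equivalent if they have respective unfoldings $\underline{PQ}$, $\underline{RS}$ and there is a horizontal translation $\tau$ with $\underline{RS}=\tau(\underline{PQ})$. $[\alpha]$ denotes the equivalence class; its period is the period of its elements. A class is called primitive if it is either $[\gamma^2]$ or a class all of whose elements are primitive orbits. *)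

(* Defs.v *)
From HB Require Import structures.
From mathcomp Require Import all_boot all_order all_fingroup all_algebra.
From mathcomp Require Import all_classical all_reals all_analysis.

Set Implicit Arguments.
Unset Strict Implicit.
Unset Printing Implicit Defensive.

Import Order.TTheory GRing.Theory Num.Theory.
Local Open Scope classical_set_scope.
Local Open Scope card_scope.
Local Open Scope ring_scope.

Section Plane.
Variable R : realType.
Implicit Types (u v d p q x : 'rV[R]_2) (k : R).

Definition vec (a b : R) : 'rV[R]_2 := \row_(j < 2) (if j == 0 then a else b).

Definition dot u v : R := \sum_j u 0 j * v 0 j.

(* The library norm on row vectors is the sup norm. *)
Definition enorm u : R := Num.sqrt (dot u u).

(* Non-obtuse angle between the lines spanned by two nonzero vectors. *)
Definition line_angle u v : R := acos (`|dot u v| / (enorm u * enorm v)).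

Definition segment p q : set 'rV[R]_2 :=
  [set x | exists2 k, 0 <= k <= 1 & x = p + k *: (q - p)].

Definition mirror d u : 'rV[R]_2 := ((2 * dot u d) / dot d d) *: d - u.

(* Reflection in the line through the distinct points p and q. *)
Definition reflect_line p q x : 'rV[R]_2 := p + mirror (q - p) (x - p).

End Plane.

(* Triangle of side length s; the vertices 0, 1, 2 are A, B, C, with BC
   horizontal at the bottom, and side i is the side opposite to vertex i. *)
Section Table.
Variables (R : realType) (s : R).

Definition vertex (i : 'I_3) : 'rV[R]_2 :=
  nth 0 [:: vec (s / 2) (s * Num.sqrt 3 / 2); vec 0 0; vec s 0] i.

Definition side_dir (i : 'I_3) : 'rV[R]_2 := vertex (i + 2) - vertex (i + 1).

Definition side (i : 'I_3) : set 'rV[R]_2 :=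
  segment (vertex (i + 1)) (vertex (i + 2)).

Definition table : set 'rV[R]_2 :=
  [set x | exists w : 'I_3 -> R,
     [/\ forall i, 0 <= w i, \sum_i w i = 1 & x = \sum_i w i *: vertex i]].

Definition boundary : set 'rV[R]_2 := [set x | exists i, side i x].

(* Tiling by the translates of the triangle by the lattice spanned by C - B
   and A - B, and of its mirror images; [node i j] runs through the vertices
   of the tiles. *)
Definition node (i j : int) : 'rV[R]_2 :=
  vertex 1 + i%:~R *: (vertex 2 - vertex 1) + j%:~R *: (vertex 0 - vertex 1).

Definition tile_edge (p q : 'rV[R]_2) : Prop :=
  exists i j : int,
    [\/ p = node i j /\ q = node (i + 1) j,
        p = node i j /\ q = node i (j + 1) |
        p = node (i + 1) j /\ q = node i (j + 1)].

Definition triangle_symmetry (f : 'rV[R]_2 -> 'rV[R]_2) : Prop :=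
  (forall x y, enorm (f x - f y) = enorm (x - y)) /\
  exists sg : 'S_3, forall i, f (vertex i) = vertex (sg i).

End Table.

Section Billiard.
Variable R : realType.

Definition departs (al : R -> 'rV[R]_2) (t : R) (v : 'rV[R]_2) : Prop :=
  exists2 e, 0 < e & forall h, 0 <= h < e -> al (t + h) = al t + h *: v.

Definition arrives (al : R -> 'rV[R]_2) (t : R) (v : 'rV[R]_2) : Prop :=
  exists2 e, 0 < e & forall h, 0 <= h < e -> al (t - h) = al t - h *: v.

Definition nonsingular_trajectory (s : R) (al : R -> 'rV[R]_2) : Prop :=
  exists2 c, 0 < c & forall t,
    [/\ table s (al t),
        forall i, al t <> vertex s i &
        exists u v,
          [/\ arrives al t u /\ departs al t v,
              enorm u = c /\ enorm v = c,
              ~ boundary s (al t) -> v = u &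
              forall i, side s i (al t) -> v = mirror (side_dir s i) u]].

(* A trajectory together with the interval [start, stop] to which it is
   restricted. *)
Record timed_curve : Type :=
  TimedCurve { curve : R -> 'rV[R]_2; start : R; stop : R }.

Definition periodic_orbit (s : R) (o : timed_curve) : Prop :=
  [/\ nonsingular_trajectory s (curve o),
      start o < stop o &
      forall t, curve o (start o + t) = curve o (stop o + t)].

(* The half-open interval counts coinciding initial and final strikes once. *)
Definition has_period (s : R) (o : timed_curve) (m : nat) : Prop :=
  [set t | start o <= t < stop o /\ boundary s (curve o t)] #= `I_m.

Definition least_time_period (al : R -> 'rV[R]_2) (T : R) : Prop :=
  [/\ 0 < T,
      forall t, al (t + T) = al t &
      forall T', 0 < T' -> (forall t, al (t + T') = al t) -> T <= T'].

Definition retraces (o : timed_curve) (n : nat) : Prop :=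
  (0 < n)%N /\
  exists2 T, least_time_period (curve o) T & stop o - start o = n%:R * T.

Definition primitive_orbit (o : timed_curve) : Prop := retraces o 1.

Definition iterate (o : timed_curve) (n : nat) : timed_curve :=
  TimedCurve (curve o) (start o) (start o + n%:R * (stop o - start o)).

Definition midpoint (s : R) (i : 'I_3) : 'rV[R]_2 :=
  2^-1 *: (vertex s (i + 1) + vertex s (i + 2)).

Definition fagnano (s : R) (o : timed_curve) : Prop :=
  [/\ periodic_orbit s o, primitive_orbit o, has_period s o 3 &
      curve o @` [set t | start o <= t <= stop o] =
      [set x | exists i, segment (midpoint s (i + 1)) (midpoint s (i + 2)) x]].

Definition relabel (f : 'rV[R]_2 -> 'rV[R]_2) (o : timed_curve) :=
  TimedCurve (fun t => f (curve o t)) (start o) (stop o).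

Definition reverse (o : timed_curve) :=
  TimedCurve (fun t => curve o (- t)) (- stop o) (- start o).

Definition change_initial (c : R) (o : timed_curve) :=
  TimedCurve (curve o) (start o + c) (stop o + c).

Definition normalization (s : R) (o o' : timed_curve) : Prop :=
  exists (f : 'rV[R]_2 -> 'rV[R]_2) (rev : bool) (c : R),
    triangle_symmetry s f /\
    o' = change_initial c (relabel f (if rev then reverse o else o)).

Definition angle_of_incidence (s : R) (al : R -> 'rV[R]_2) (t : R)
    (i : 'I_3) (theta : R) : Prop :=
  side s i (al t) /\
  exists2 u, arrives al t u & theta = line_angle u (side_dir s i).

(* Side 0 is BC. *)
Definition standard_position (s : R) (o : timed_curve) : Prop :=
  (exists2 theta, angle_of_incidence s (curve o) (start o) 0 theta &
                  pi / 6 <= theta <= pi / 3) /\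
  exists2 v, departs (curve o) (start o) v & 0 < v 0 0 /\ 0 < v 0 1.

(* t 0 < ... < t m are the strike times on [start, stop] and g k is the
   composite of the first k reflections.  The directed segment PQ is encoded
   by its endpoints. *)
Definition unfolds_to (s : R) (o : timed_curve) (P Q : 'rV[R]_2) : Prop :=
  exists (m : nat) (t : nat -> R) (g : nat -> 'rV[R]_2 -> 'rV[R]_2),
    [/\ has_period s o m,
        [/\ t 0%N = start o, t m = stop o,
            forall k, (k < m)%N -> t k < t k.+1 &
            forall r, start o <= r <= stop o ->
              (boundary s (curve o r) <-> exists2 k, (k <= m)%N & r = t k)],
        g 0%N = id,
        forall k, (k.+1 < m)%N -> exists p q,
          [/\ tile_edge s p q,
              segment p q (g k (curve o (t k.+1))) &
              g k.+1 = reflect_line p q \o g k] &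
        P = curve o (start o) /\ Q = g m.-1 P].

Definition unfolding (s : R) (o : timed_curve) (P Q : 'rV[R]_2) : Prop :=
  exists o', [/\ normalization s o o', standard_position s o' &
                 unfolds_to s o' P Q].

Definition equivalent (s : R) (o o' : timed_curve) : Prop :=
  exists P Q P' Q' : 'rV[R]_2,
    [/\ unfolding s o P Q, unfolding s o' P' Q' &
        exists h, P' = P + vec h 0 /\ Q' = Q + vec h 0].

Definition class_of (s : R) (o : timed_curve) : set timed_curve :=
  [set o' | periodic_orbit s o' /\ equivalent s o o'].

Definition orbit_classes (s : R) (m : nat) : set (set timed_curve) :=
  [set K | (exists2 o, periodic_orbit s o & K = class_of s o) /\
           (forall o, K o -> has_period s o m)].

Definition primitive_class (s : R) (K : set timed_curve) : Prop :=
  (exists2 o, fagnano s o & K = class_of s (iterate o 2)) \/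
  (forall o, K o -> primitive_orbit o).

Definition primitive_orbit_classes (s : R) (m : nat) : set (set timed_curve) :=
  [set K | orbit_classes s m K /\ primitive_class s K].

End Billiard.

Definition has_card (T : Type) (X : set T) (z : int) : Prop :=
  exists2 k : nat, X #= `I_k & z = k%:Z.

Definition squarefree (n : nat) : bool :=
  all (fun p => logn p n == 1%N) (primes n).

Definition moebius (n : nat) : int :=
  if squarefree n then (-1) ^+ size (primes n) else 0.

Definition num_classes (m : nat) : int :=
  ((m + 2) %/ 2)%N%:Z - ((m + 2) %/ 3)%N%:Z.

Definition num_primitive_classes (n : nat) : int :=
  \sum_(d <- divisors n) moebius d * num_classes (n %/ d).

(* Main.v *)
Require Import Defs.
From HB Require Import structures.
From mathcomp Require Import all_boot all_order all_algebra.
From mathcomp Require Import fingroup perm.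
From mathcomp Require Import all_classical all_reals all_analysis.
From mathcomp Require Import zify ring lra.

Set Implicit Arguments.
Unset Strict Implicit.
Unset Printing Implicit Defensive.

Import Order.TTheory GRing.Theory Num.Theory.
Local Open Scope classical_set_scope.
Local Open Scope card_scope.
Local Open Scope ring_scope.

(** Reflecting the table instead of the trajectory turns an orbit into a straight
    line in a plane tiled by copies of the triangle ([unfolding_line]). In the
    affine coordinates x, y along BC and BA, with origin B and unit side, the
    lines of the tiling are those on which x, y or x + y is an integer, and the
    reflections in the sides generate the group of the maps composed of a linear
    map among six and a translation by integers (a, b) with a = b modulo 3. The
    triangle is a fundamental domain of this group ([inW_table], [inW_cover]).

    Over one period the reflections compose to an element of the group that
    preserves the direction of the line ([standard_holonomy]). Either it is a
    translation, by a vector (m, m + 3 k) of the lattice once the direction is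
    normalized to lie between 30 and 60 degrees, or it is a glide reflection and
    the orbit is an odd iterate of the Fagnano orbit. The strikes are the
    crossings of the three families of lines, so there are
    2 m + 2 (m + 3 k) = 2 (2 m + 3 k) of them in the first case and an odd number
    in the second ([standard_strikes]).

    The displacement of the unfolding is determined by the orbit: its duration is
    fixed, and its direction is the only one in the cone with the conserved values
    of two invariants of the velocity ([standard_velocity_uniq]). All unfoldings
    start on the line BC, so equivalence means equality of displacements
    ([equivalentE]), and every periodic orbit has an unfolding ([normalizable]).
    Conversely each nonzero vector (m, m + 3 k) is realized by folding a line that
    avoids the nodes ([lattice_orbit]). Hence the classes of period 2 n correspond
    to the representations n = 2 m + 3 k ([orbit_classesE]), which are counted by
    an induction with step 2.

    An orbit with coprime (m, k) and m > 0 has no shorter period, because this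
    period would have a holonomy vector as well ([coprime_primitive]); if d > 1
    divides m and k, the folded line retraces its path. The coprime pair (0, 1) is
    the class of the double of the Fagnano orbit ([fagnano_ex],
    [fagnano_vector]). So primitive classes correspond to coprime
    representations, and Moebius inversion counts them ([size_prim_reps23]). *)

(** * Representations as 2a + 3k and Moebius inversion *)

Definition rep23 (n k : nat) : bool := (3 * k <= n)%N && ~~ odd (n - 3 * k).

Definition reps23 (n : nat) : seq nat := [seq k <- iota 0 n.+1 | rep23 n k].

Lemma mem_reps23 n k : (k \in reps23 n) = rep23 n k.
Proof.
rewrite mem_filter mem_iota /=; case: (boolP (rep23 n k)) => //= /andP[h _]; lia.
Qed.

Lemma reps23_uniq n : uniq (reps23 n).
Proof. by rewrite filter_uniq // iota_uniq. Qed.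

Lemma rep23P n k : reflect (exists a, n = 2 * a + 3 * k)%N (rep23 n k).
Proof.
apply: (iffP andP) => [[h1 h2]|[a ->]]; first by exists ((n - 3 * k)./2); lia.
by split; lia.
Qed.

Lemma size_reps23 n : (size (reps23 n))%:Z = num_classes n.
Proof.
(* Adding 1 to a maps the representations 2a + 3k of m to those of m + 2 with
   a > 0; the one with a = 0 exists when 3 divides m + 2. *)
have step m : size (reps23 m.+2) = (size (reps23 m) + (3 %| m.+2)%N)%N.
  have -> : size (reps23 m.+2) =
      size [seq k <- iota 0 m.+3 | rep23 m k || (3 * k == m.+2)%N].
    congr size; apply: eq_filter => k; rewrite /rep23.
    by apply/idP/idP; lia.
  rewrite !size_filter -(addn0 (count (rep23 m) _)).
  rewrite (_ : m.+3 = m.+1 + 2)%N; last by lia.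
  have -> : count (fun k => rep23 m k || (3 * k == m.+2)%N) (iota 0 (m.+1 + 2)) =
    (count (rep23 m) (iota 0 (m.+1 + 2)) + count (fun k => (3 * k == m.+2)%N) (iota 0 (m.+1 + 2)))%N.
    rewrite -count_predUI.
    rewrite [X in _ = (_ + X)%N](_ : _ = 0%N) ?addn0 //.
    apply/eqP; rewrite -leqn0 leqNgt -has_count; apply/hasPn => k _ /=.
    rewrite /rep23; lia.
  rewrite addn0; congr addn.
    rewrite iotaD count_cat /= [X in (_ + X)%N](_ : _ = 0%N) ?addn0 //.
    by rewrite /rep23; lia.
  case: (boolP (3 %| m.+2)%N) => h.
    rewrite (eq_count (a2 := pred1 (m.+2 %/ 3)%N)); last by move=> k /=; lia.
    by rewrite count_uniq_mem ?iota_uniq // mem_iota; lia.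
  apply/eqP; rewrite -leqn0 leqNgt -has_count; apply/hasPn => k _ /=; lia.
suff: forall n, (size (reps23 n))%:Z = num_classes n /\
  (size (reps23 n.+1))%:Z = num_classes n.+1 by move=> /(_ n)[].
elim=> [|m [IH1 IH2]]; first by [].
split=> //; rewrite step; move: IH1; rewrite /num_classes; lia.
Qed.

Lemma moebius_prime_mul p d : prime p -> ~~ (p %| d)%N -> (0 < d)%N ->
  moebius (p * d)%N = - moebius d.
Proof.
move=> pp pd d0.
have pm : (0 < p * d)%N by rewrite muln_gt0 prime_gt0.
have peq : perm_eq (primes (p * d)%N) (p :: primes d).
  apply: uniq_perm; rewrite /= ?primes_uniq //.
    by rewrite mem_primes (negbTE pd) !andbF.
  by move=> q; rewrite in_cons primesM ?(prime_gt0 pp) // (primes_prime pp) mem_seq1.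
rewrite /moebius (perm_size peq) /= /squarefree (perm_all _ peq) /=.
rewrite lognM ?(prime_gt0 pp) // logn_prime // eqxx (lognE p d) (negbTE pd) !andbF /=.
rewrite (_ : all _ (primes d) = all (fun q => logn q d == 1%N) (primes d)).
  by case: all; rewrite ?oppr0 // exprS mulN1r.
apply: eq_in_all => q qd; rewrite lognM ?(prime_gt0 pp) // logn_prime //.
suff -> : (q == p) = false by []. apply: contraTF qd => /eqP ->; by rewrite mem_primes (negbTE pd) !andbF.
Qed.

Lemma moebius_sq_mul p d : prime p -> (0 < d)%N -> (p %| d)%N ->
  moebius (p * d)%N = 0.
Proof.
move=> pp d0 pd; rewrite /moebius ifN //; apply/allPn; exists p.
  by rewrite mem_primes pp muln_gt0 prime_gt0 //= d0 dvdn_mulr.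
rewrite lognM ?(prime_gt0 pp) // logn_prime // eqxx.
by rewrite (lognE p d) pp d0 pd.
Qed.

(** Toggling a fixed prime factor pairs the squarefree divisors of n into
    couples of opposite signs. *)
Lemma sum_moebius n : (0 < n)%N ->
  \sum_(d <- divisors n) moebius d = (n == 1%N)%:R.
Proof.
move=> n0; case: eqVneq => [->|n1]; first by rewrite (_ : divisors 1 = [:: 1%N]) // big_seq1.
have [p pp pn] : exists2 p, prime p & (p %| n)%N.
  by exists (pdiv n); rewrite ?pdiv_dvd // pdiv_prime; lia.
have p0 : (0 < p)%N by apply: prime_gt0.
have np0 : (0 < n %/ p)%N by rewrite divn_gt0 // dvdn_leq.
rewrite (bigID (fun d => p %| d)%N) /=.
have perm_mul : perm_eq [seq d <- divisors n | (p %| d)%N] [seq (p * d)%N | d <- divisors (n %/ p)].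
  apply: uniq_perm; rewrite ?filter_uniq ?divisors_uniq //.
    by rewrite map_inj_uniq ?divisors_uniq // => x y /eqP; rewrite eqn_pmul2l // => /eqP.
  move=> d; rewrite mem_filter -dvdn_divisors //; apply/andP/mapP => [[pd dn]|[e]].
    exists (d %/ p)%N; last by rewrite mulnC divnK.
    rewrite -(dvdn_divisors _ np0).
    by rewrite dvdn_divRL // divnK.
  rewrite -(dvdn_divisors _ np0) => en ->.
  by rewrite dvdn_mulr // mulnC -dvdn_divRL.
rewrite -big_filter (perm_big _ perm_mul) /= big_map.
rewrite (bigID (fun d => p %| d)%N) /= big1_seq ?add0r; last first.
  move=> d /andP[pd]; rewrite -(dvdn_divisors _ np0) => dn.
  by rewrite moebius_sq_mul // (dvdn_gt0 np0 dn).
apply/eqP; rewrite addr_eq0 -sumrN; apply/eqP.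
rewrite -big_filter -[RHS]big_filter.
rewrite (perm_big [seq d <- divisors n | ~~ (p %| d)%N]) /=; last first.
  apply: uniq_perm; rewrite ?filter_uniq ?divisors_uniq // => d.
  rewrite !mem_filter -(dvdn_divisors _ np0) -(dvdn_divisors _ n0).
  case: (boolP (p %| d)%N) => //= pd; rewrite dvdn_divRL // -{2}(divnK pn).
  apply/idP/idP => [h|]; first by rewrite divnK //; apply: dvdn_trans h; rewrite dvdn_mulr.
  by rewrite divnK // => dn; rewrite Gauss_dvd ?dn // coprime_sym prime_coprime.
rewrite big_seq [RHS]big_seq; apply: eq_bigr => d.
rewrite mem_filter -dvdn_divisors // => /andP[pd dn].
by rewrite moebius_prime_mul // (dvdn_gt0 n0 dn).
Qed.

Definition prim_reps23 n := [seq k <- reps23 n | coprime ((n - 3 * k)./2) k].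

Lemma size_dvd_reps23 n d : (0 < d)%N -> (d %| n)%N ->
  size [seq k <- reps23 n | (d %| gcdn ((n - 3 * k)./2) k)%N] =
  size (reps23 (n %/ d)).
Proof.
move=> d0 /dvdnP[m ->]; rewrite mulnK //.
rewrite -(size_map (muln d) (reps23 m)); apply/perm_size/uniq_perm.
- by rewrite filter_uniq // reps23_uniq.
- rewrite map_inj_uniq ?reps23_uniq // => x y /eqP.
  by rewrite eqn_pmul2l // => /eqP.
move=> k; rewrite mem_filter mem_reps23; apply/andP/mapP.
  case=> + /rep23P[a e]; rewrite dvdn_gcd (_ : (_./2) = a); last by lia.
  move=> /andP[/dvdnP[a' ea] /dvdnP[k' ek]]; exists k'; last by rewrite mulnC.
  rewrite mem_reps23; apply/rep23P; exists a'; apply/eqP.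
  by rewrite -(eqn_pmul2r d0); apply/eqP; rewrite e; lia.
case=> k'; rewrite mem_reps23 => /rep23P[a' ->] ->; split.
  rewrite dvdn_gcd dvdn_mulr // andbT (_ : (_./2) = d * a')%N ?dvdn_mulr //.
  by rewrite mulnDl (_ : 3 * (d * k') = 3 * k' * d)%N ?addnK; lia.
by apply/rep23P; exists (d * a')%N; lia.
Qed.

(** Moebius inversion: the indicator of gcd 1 is the sum of moebius over the
    divisors of the gcd, and these divide n. *)
Lemma size_prim_reps23 n : (0 < n)%N ->
  (size (prim_reps23 n))%:Z = num_primitive_classes n.
Proof.
move=> n0; rewrite /num_primitive_classes /prim_reps23.
have g0 k : k \in reps23 n -> (0 < gcdn ((n - 3 * k)./2) k)%N /\
    (gcdn ((n - 3 * k)./2) k %| n)%N.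
  rewrite mem_reps23 => /rep23P[a e].
  rewrite (_ : (_./2) = a); last by lia.
  split; first by rewrite gcdn_gt0; lia.
  rewrite e dvdn_add // dvdn_mull ?dvdn_gcdl ?dvdn_gcdr //.
transitivity (\sum_(k <- reps23 n) \sum_(d <- divisors n | (d %| gcdn ((n - 3 * k)./2) k)%N) moebius d).
  rewrite size_filter -sum1_count big_mkcond /= -[LHS]natz natr_sum.
  rewrite big_seq [RHS]big_seq; apply: eq_bigr => k kn.
  have [gk gn] := g0 k kn.
  transitivity (\sum_(d <- divisors (gcdn ((n - 3 * k)./2) k)) moebius d).
    by rewrite sum_moebius // /coprime; case: eqP.
  rewrite -[RHS]big_filter; apply/perm_big/uniq_perm.
  - exact: divisors_uniq.
  - by rewrite filter_uniq // divisors_uniq.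
  move=> d; rewrite mem_filter -!dvdn_divisors //.
  by apply/idP/andP => [h|[]//]; split=> //; apply: dvdn_trans gn.
under eq_bigr do rewrite big_mkcond /=.
rewrite exchange_big /= big_seq [RHS]big_seq; apply: eq_bigr => d.
rewrite -dvdn_divisors // => dn.
rewrite -size_reps23 -(size_dvd_reps23 (dvdn_gt0 n0 dn) dn).
by rewrite -big_mkcond -big_filter big_const_seq count_predT iter_addr_0 -mulr_natr natz.
Qed.

(** * Affine coordinates in which the triangle is the unit simplex *)

Lemma ord3_ind (P : 'I_3 -> Prop) : P 0 -> P 1 -> P 2 -> forall i, P i.
Proof.
move=> P0 P1 P2 [[|[|[|//]]] hi].
- by rewrite (_ : Ordinal hi = 0) //; apply: val_inj.
- by rewrite (_ : Ordinal hi = 1) //; apply: val_inj.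
- by rewrite (_ : Ordinal hi = 2) //; apply: val_inj.
Qed.

Lemma ord3_add : [/\ (0 + 1 = 1 :> 'I_3), (0 + 2 = 2 :> 'I_3) &
  (1 + 1 = 2 :> 'I_3)] /\ [/\ (1 + 2 = 0 :> 'I_3), (2 + 1 = 0 :> 'I_3) &
  (2 + 2 = 1 :> 'I_3)].
Proof. by do !split; apply: val_inj. Qed.

Lemma sum3 (V : nmodType) (F : 'I_3 -> V) : \sum_i F i = F 0 + F 1 + F 2.
Proof.
rewrite !big_ord_recl big_ord0 addr0 addrA.
by congr (_ + F _ + F _); apply: val_inj.
Qed.

Section Coordinates.
Variables (R : realType) (s : R).
Hypothesis s_gt0 : 0 < s.
Implicit Types (p q u v d : 'rV[R]_2) (k x y : R).

Let q3 : R := Num.sqrt 3.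
Let q3_gt0 : 0 < q3. Proof. by rewrite sqrtr_gt0. Qed.
Let q3_sq : q3 * q3 = 3. Proof. by rewrite -expr2 sqr_sqrtr. Qed.

(** Affine coordinates with origin B, where C is (1, 0) and A is (0, 1): the
    nodes of the tiling are the integer points and its lines have integer
    equations. *)
Definition coordY p : R := p 0 1 / (s * (Num.sqrt 3 / 2)).
Local Notation YC := coordY.
Definition coordX p : R := p 0 0 / s - YC p / 2.
Local Notation XC := coordX.
Definition at_coords x y : 'rV[R]_2 := vec (s * (x + y / 2)) (s * (Num.sqrt 3 / 2) * y).
Local Notation pt := at_coords.

Let s_neq0 : s != 0. Proof. by rewrite gt_eqF. Qed.
Let hs_neq0 : s * (q3 / 2) != 0.
Proof. by rewrite mulf_neq0 ?mulf_neq0 ?gt_eqF. Qed.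

Lemma vec_0 (a b : R) : vec a b 0 0 = a. Proof. by rewrite mxE. Qed.
Lemma vec_1 (a b : R) : vec a b 0 1 = b. Proof. by rewrite mxE. Qed.

Lemma YC_pt x y : YC (pt x y) = y.
Proof. by rewrite /YC vec_1 mulrC mulKf. Qed.
Lemma XC_pt x y : XC (pt x y) = x.
Proof. by rewrite /XC YC_pt vec_0 mulrC mulKf // addrK. Qed.

Lemma YCD p q : YC (p + q) = YC p + YC q.
Proof. by rewrite /YC mxE mulrDl. Qed.
Lemma YCZ k p : YC (k *: p) = k * YC p.
Proof. by rewrite /YC mxE mulrA. Qed.
Lemma XCD p q : XC (p + q) = XC p + XC q.
Proof. by rewrite /XC YCD mxE; ring. Qed.
Lemma XCZ k p : XC (k *: p) = k * XC p.
Proof. by rewrite /XC YCZ mxE; ring. Qed.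
Lemma YCN p : YC (- p) = - YC p.
Proof. by rewrite -scaleN1r YCZ mulN1r. Qed.
Lemma XCN p : XC (- p) = - XC p.
Proof. by rewrite -scaleN1r XCZ mulN1r. Qed.
Lemma YC0 : YC 0 = 0. Proof. by rewrite -(scale0r 0) YCZ mul0r. Qed.
Lemma XC0 : XC 0 = 0. Proof. by rewrite -(scale0r 0) XCZ mul0r. Qed.
Definition coord_rules := (XCD, YCD, XCZ, YCZ, XCN, YCN, XC_pt, YC_pt, XC0, YC0).
Local Notation coordD := coord_rules.

Lemma entry1 p : p 0 1 = s * (q3 / 2) * YC p.
Proof. by rewrite /YC -/q3 mulrC divfK. Qed.
Lemma entry0 p : p 0 0 = s * (XC p + YC p / 2).
Proof. by rewrite /XC subrK mulrC divfK. Qed.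

Lemma coord_inj p q : XC p = XC q -> YC p = YC q -> p = q.
Proof.
move=> hx hy; apply/rowP => j; case: (unliftP ord0 j) => [i|] ->.
  by rewrite ord1 (_ : lift _ _ = 1) ?entry1 ?hy //; apply: val_inj.
by rewrite !entry0 hx hy.
Qed.

Lemma dotE u v : dot u v =
  s ^+ 2 * (XC u * XC v + YC u * YC v + (XC u * YC v + YC u * XC v) / 2).
Proof.
rewrite /dot big_ord_recl big_ord1 (_ : lift _ _ = 1); last exact: val_inj.
rewrite !entry1 !entry0.
transitivity (s ^+ 2 * ((XC u + YC u / 2) * (XC v + YC v / 2) +
   q3 * q3 / 4 * YC u * YC v)); first by field.
by rewrite q3_sq; field.
Qed.

(** The squared Euclidean norm in these coordinates, for side length 1. *)
Definition sqnorm u : R := XC u ^+ 2 + XC u * YC u + YC u ^+ 2.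
Local Notation NC := sqnorm.

Lemma enorm_sq u : enorm u ^+ 2 = s ^+ 2 * NC u.
Proof.
rewrite /enorm sqr_sqrtr; last by rewrite /dot sumr_ge0 // => j _; rewrite -expr2 sqr_ge0.
by rewrite dotE /NC; field.
Qed.

(** All edges of the tiling have sqnorm 1. *)
Lemma mirrorE d u : NC d = 1 -> mirror d u =
  (2 * XC u * XC d + 2 * YC u * YC d + (XC u * YC d + YC u * XC d)) *: d - u.
Proof.
move=> dN; rewrite /mirror; congr (_ *: _ - _).
have -> : dot d d = s ^+ 2 by rewrite -[RHS]mulr1 -dN dotE /NC; field.
by rewrite dotE; field.
Qed.

Lemma vertexE : [/\ vertex s 0 = pt 0 1, vertex s 1 = pt 0 0 & vertex s 2 = pt 1 0].
Proof. by split; rewrite /vertex /pt /=; congr vec; field. Qed.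

(** In the order A, B, C, so that index i vanishes on side i. *)
Definition barycentric (i : 'I_3) p : R := nth 0 [:: YC p; 1 - XC p - YC p; XC p] i.
Local Notation bar := barycentric.
Definition side_rate (i : 'I_3) u : R := nth 0 [:: YC u; - XC u - YC u; XC u] i.
Local Notation rate := side_rate.

Lemma rateD i u v : rate i (u + v) = rate i u + rate i v.
Proof. by elim/ord3_ind: i; rewrite /rate /= ?coordD //; ring. Qed.
Lemma rateZ i k u : rate i (k *: u) = k * rate i u.
Proof. by elim/ord3_ind: i; rewrite /rate /= ?coordD //; ring. Qed.
Lemma rateN i u : rate i (- u) = - rate i u.
Proof. by rewrite -scaleN1r rateZ mulN1r. Qed.
Lemma barE i p : bar i p = rate i p + (i == 1)%:R.
Proof. by elim/ord3_ind: i; rewrite /bar /rate /= ?addr0 //; ring. Qed.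
Lemma barD i p u : bar i (p + u) = bar i p + rate i u.
Proof. by rewrite !barE rateD; ring. Qed.
Lemma bar_sum p : bar 0 p + bar 1 p + bar 2 p = 1.
Proof. by rewrite /bar /=; ring. Qed.
Lemma rate_sum u : rate 0 u + rate 1 u + rate 2 u = 0.
Proof. by rewrite /rate /=; ring. Qed.

Lemma bar_inj p q : (forall i, bar i p = bar i q) -> p = q.
Proof. by move=> h; apply: coord_inj; [exact: (h 2)|exact: (h 0)]. Qed.

Lemma rate_inj p q : (forall i, rate i p = rate i q) -> p = q.
Proof. by move=> h; apply: coord_inj; [exact: (h 2)|exact: (h 0)]. Qed.

Lemma bar_vertex i j : bar i (vertex s j) = (i == j)%:R.
Proof.
have [v0 v1 v2] := vertexE.
by elim/ord3_ind: j; rewrite ?v0 ?v1 ?v2; elim/ord3_ind: i;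
  rewrite /bar /= ?coordD /=; ring.
Qed.

Lemma tableP p : table s p <-> forall i, 0 <= bar i p.
Proof.
have [v0 v1 v2] := vertexE; split.
  case=> w [w0]; rewrite !sum3 v0 v1 v2 => w1 -> i.
  by elim/ord3_ind: i; rewrite /bar /= !coordD; [have := w0 0|have := w0 1|have := w0 2]; lra.
move=> h; exists (fun i => bar i p); split=> //; rewrite sum3 ?bar_sum //.
by rewrite v0 v1 v2; apply: coord_inj; rewrite !coordD /bar /=; ring.
Qed.

Lemma tableE p : table s p <-> [/\ 0 <= XC p, 0 <= YC p & XC p + YC p <= 1].
Proof.
rewrite tableP; split=> [h|[h1 h2 h3] i].
  by have := h 0; have := h 1; have := h 2; rewrite /bar /= => h1 h2 h3; split; lra.
by elim/ord3_ind: i; rewrite /bar /=; lra.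
Qed.

Lemma sideP i p : side s i p <-> table s p /\ bar i p = 0.
Proof.
have [v0 v1 v2] := vertexE; have [[e1 e2 e3] [e4 e5 e6]] := ord3_add.
rewrite tableE /side /segment /=; elim/ord3_ind: i;
  rewrite ?e1 ?e2 ?e3 ?e4 ?e5 ?e6 ?v0 ?v1 ?v2 /bar /=; split.
- case=> k /andP[k0 k1] ->; rewrite !coordD; split; [split|]; lra.
- case=> [[h1 h2 h3] h]; exists (XC p); first by apply/andP; split; lra.
  by apply: coord_inj; rewrite !coordD; lra.
- case=> k /andP[k0 k1] ->; rewrite !coordD; split; [split|]; lra.
- case=> [[h1 h2 h3] h]; exists (YC p); first by apply/andP; split; lra.
  by apply: coord_inj; rewrite !coordD; lra.
- case=> k /andP[k0 k1] ->; rewrite !coordD; split; [split|]; lra.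
- case=> [[h1 h2 h3] h]; exists (1 - YC p); first by apply/andP; split; lra.
  by apply: coord_inj; rewrite !coordD; lra.
Qed.

(** In barycentric rates a reflection has a form that does not depend on the
    labels, and the metric disappears from the reflection law. *)
Lemma rate_mirror i j u : rate j (mirror (side_dir s i) u) =
  rate j u + (if j == i then - 2 else 1) * rate i u.
Proof.
have [v0 v1 v2] := vertexE; have [[e1 e2 e3] [e4 e5 e6]] := ord3_add.
rewrite mirrorE; last first.
  by rewrite /side_dir; elim/ord3_ind: i;
    rewrite ?e1 ?e2 ?e3 ?e4 ?e5 ?e6 ?v0 ?v1 ?v2 /NC !coordD; ring.
rewrite /side_dir; elim/ord3_ind: i;
   rewrite ?e1 ?e2 ?e3 ?e4 ?e5 ?e6 ?v0 ?v1 ?v2; elim/ord3_ind: j;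
   by rewrite /rate /= !coordD; field.
Qed.

Lemma node_pt (i j : int) : node s i j = pt i%:~R j%:~R.
Proof.
have [v0 v1 v2] := vertexE.
by rewrite /node v0 v1 v2; apply: coord_inj; rewrite !coordD; ring.
Qed.

End Coordinates.

(** * The group generated by the reflections in the sides *)

(** The linear parts of the products of side reflections: identity, the two
    rotations by 120 degrees and the reflections in the directions of the
    sides 0, 1, 2. Enumerating them reduces most facts about the group to
    linear arithmetic. *)
Inductive weyl := WId | WRot | WRotV | WRef0 | WRef1 | WRef2.

Definition odd_weyl k : bool :=
  match k with WId | WRot | WRotV => false | _ => true end.

Definition wx (V : zmodType) k (x y : V) : V :=
  match k with
  | WId => x | WRot => - x - y | WRotV => y
  | WRef0 => x + y | WRef1 => - y | WRef2 => - x
  end.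

Definition wy (V : zmodType) k (x y : V) : V :=
  match k with
  | WId => y | WRot => x | WRotV => - x - y
  | WRef0 => - y | WRef1 => - x | WRef2 => x + y
  end.

Section Integrality.
Variable R : realType.
Implicit Types x y : R.

Definition isint x := exists m : int, x = m%:~R.

Lemma isint_small x : isint x -> -1 < x -> x < 1 -> x = 0.
Proof.
case=> m ->; rewrite -[1]/(1%:~R) -[-1 in X in X -> _]mulrN1z.
rewrite !ltr_int => h1 h2; have -> : m = 0 by lia.
by [].
Qed.

Lemma isintD x y : isint x -> isint y -> isint (x + y).
Proof. by case=> a -> [b ->]; exists (a + b); rewrite intrD. Qed.
Lemma isintN x : isint x -> isint (- x).
Proof. by case=> a ->; exists (- a); rewrite mulrNz. Qed.
Lemma isint_int (m : int) : isint m%:~R.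
Proof. by exists m. Qed.

End Integrality.

Section UnfoldingGroup.
Variables (R : realType) (s : R).
Hypothesis s_gt0 : 0 < s.
Implicit Types (p q u v d : 'rV[R]_2) (k : weyl) (g : 'rV[R]_2 -> 'rV[R]_2).

Local Notation XC := (coordX s).
Local Notation YC := (coordY s).
Local Notation pt := (at_coords s).
Local Notation rate := (side_rate s).
Local Notation NC := (sqnorm s).
Local Notation coordD := (coord_rules s_gt0).
Local Notation cinj := (coord_inj s_gt0).

Definition weyl_act k u := pt (wx k (XC u) (YC u)) (wy k (XC u) (YC u)).
Local Notation wl := weyl_act.

(** The translations that preserve the colouring of the nodes by the vertices
    A, B, C: both coordinates agree modulo 3. *)
Definition lattice_shift (b c : int) := pt (b + 3 * c)%:~R b%:~R.
Local Notation tr := lattice_shift.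

(** The group generated by the reflections in the sides, as a set: it is the
    semidirect product of the six linear maps and the lattice of shifts. The
    linear part k is kept explicit for its parity and its action on
    velocities. *)
Definition unfolding_elt k g := exists b c : int, forall p, g p = wl k p + tr b c.
Local Notation inW := unfolding_elt.

Lemma wlD k u v : wl k (u + v) = wl k u + wl k v.
Proof. by apply: cinj; rewrite !coordD; case: k => /=; ring. Qed.
Lemma wlZ k a u : wl k (a *: u) = a *: wl k u.
Proof. by apply: cinj; rewrite !coordD; case: k => /=; ring. Qed.
Lemma wl1 u : wl WId u = u.
Proof. by apply: cinj; rewrite !coordD. Qed.

Lemma wl_tr k b c : exists b' c', wl k (tr b c) = tr b' c'.
Proof.
exists (wy k (b + 3 * c) b).
suff [m hm] : exists m : int, wx k (b + 3 * c) b - wy k (b + 3 * c) b = 3 * m.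
  exists m; apply: cinj; rewrite !coordD -?hm; case: k {hm} => /=; ring.
case: k => /=; [exists c|exists (- b - 2 * c)|exists (b + c)|exists (b + c)|exists c|
  exists (- b - 2 * c)]; ring.
Qed.

Lemma trD b c b' c' : tr b c + tr b' c' = tr (b + b') (c + c').
Proof. by apply: cinj; rewrite !coordD; ring. Qed.
Lemma trN b c : - tr b c = tr (- b) (- c).
Proof. by apply: cinj; rewrite !coordD; ring. Qed.
Lemma tr0 : tr 0 0 = 0.
Proof. by apply: cinj; rewrite !coordD; ring. Qed.

Lemma wl_comp k k' : exists k'',
  odd_weyl k'' = odd_weyl k (+) odd_weyl k' /\
  forall u, wl k'' u = wl k (wl k' u).
Proof.
case: k; case: k';
  first [exists WId; split; [reflexivity|by move=> u; apply: cinj; rewrite !coordD /=; ring]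
        |exists WRot; split; [reflexivity|by move=> u; apply: cinj; rewrite !coordD /=; ring]
        |exists WRotV; split; [reflexivity|by move=> u; apply: cinj; rewrite !coordD /=; ring]
        |exists WRef0; split; [reflexivity|by move=> u; apply: cinj; rewrite !coordD /=; ring]
        |exists WRef1; split; [reflexivity|by move=> u; apply: cinj; rewrite !coordD /=; ring]
        |exists WRef2; split; [reflexivity|by move=> u; apply: cinj; rewrite !coordD /=; ring]].
Qed.

Lemma wl_inv k : exists k', odd_weyl k' = odd_weyl k /\
  forall u, wl k' (wl k u) = u.
Proof.
exists (match k with WRot => WRotV | WRotV => WRot | k => k end).
by case: k; split=> // u; apply: cinj; rewrite !coordD /=; ring.
Qed.

Lemma inW_id : inW WId id.
Proof. by exists 0, 0 => p; rewrite tr0 addr0 wl1. Qed.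

Lemma inW_comp k k' g g' : inW k g -> inW k' g' -> exists k'',
  [/\ odd_weyl k'' = odd_weyl k (+) odd_weyl k',
      forall u, wl k'' u = wl k (wl k' u) & inW k'' (g \o g')].
Proof.
case=> b [c hg] [b' [c' hg']]; have [k'' [ ok hk]] := wl_comp k k'.
exists k''; split=> //; have [b1 [c1 h1]] := wl_tr k b' c'.
exists (b1 + b), (c1 + c) => p /=.
by rewrite hg hg' wlD hk h1 -addrA trD.
Qed.

Lemma inW_inv k g : inW k g -> exists k' g',
  [/\ odd_weyl k' = odd_weyl k, forall u, wl k' (wl k u) = u, inW k' g' &
      forall p, g' (g p) = p].
Proof.
case=> b [c hg]; have [k' [ ok hk]] := wl_inv k.
have [b1 [c1 h1]] := wl_tr k' b c.
exists k', (fun p => wl k' p - tr b1 c1); split=> //.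
  by exists (- b1), (- c1) => p; rewrite -trN.
by move=> p /=; rewrite hg wlD hk h1 addrK.
Qed.

Lemma inW_inj k g : inW k g -> injective g.
Proof.
by move=> /inW_inv[k' [g' [_ _ _ gK]]] p q e; rewrite -(gK p) e gK.
Qed.

Lemma inW_add k g p u : inW k g -> g (p + u) = g p + wl k u.
Proof. by case=> b [c hg]; rewrite !hg wlD addrAC. Qed.

Lemma inW_lin k k' g : inW k g -> inW k' g -> forall u, wl k u = wl k' u.
Proof.
move=> hg hg' u; apply: (addrI (g 0)).
by rewrite -(inW_add _ _ hg) -(inW_add _ _ hg').
Qed.

(** Each of the six maps permutes the three families of lines; the common sign
    is the parity of that permutation. *)
Lemma wl_rate k i : exists j, forall u, rate i (wl k u) =
  (if odd_weyl k then -1 else 1) * rate j u.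
Proof.
by elim/ord3_ind: i; case: k;
  first [exists 0; by move=> u; rewrite /side_rate /= !coordD /=; ring
        |exists 1; by move=> u; rewrite /side_rate /= !coordD /=; ring
        |exists 2; by move=> u; rewrite /side_rate /= !coordD /=; ring].
Qed.

Lemma NC_wl k u : NC (wl k u) = NC u.
Proof. by rewrite /sqnorm !coordD; case: k => /=; ring. Qed.

(** The triangle is a fundamental domain: the congruence modulo 3 excludes
    every shift that could bring a point of the triangle onto another one. *)
Lemma inW_table k g p : inW k g -> table s p -> table s (g p) -> g p = p.
Proof.
case=> b [c hg] /(tableE s_gt0)[x0 y0 xy1] /(tableE s_gt0)[].
rewrite !hg !coordD => x0' y0' xy1'.
have hb1 : (-2)%:~R < b%:~R :> R by case: k {hg} x0' y0' xy1' => /=; lra.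
have hb2 : b%:~R < 3%:~R :> R by case: k {hg} x0' y0' xy1' => /=; lra.
have hc1 : (-2)%:~R < c%:~R :> R.
  by move: x0' y0' xy1'; rewrite intrD intrM; case: k {hg} => /=; lra.
have hc2 : c%:~R < 2%:~R :> R.
  by move: x0' y0' xy1'; rewrite intrD intrM; case: k {hg} => /=; lra.
rewrite !ltr_int in hb1 hb2 hc1 hc2.
have hb : b = -1 \/ b = 0 \/ b = 1 \/ b = 2 by lia.
have hc : c = -1 \/ c = 0 \/ c = 1 by lia.
apply: cinj; move: x0' y0' xy1'; rewrite !coordD intrD intrM {hg};
  case: hb => [->|[->|[->|->]]];
  case: hc => [->|[->|->]]; case: k => /=; lra.
Qed.

(** A translation other than the identity fixes nothing, and the centre of a
    rotation is a node. *)
Lemma inW_fix k g p : inW k g -> ~~ odd_weyl k -> g p = p ->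
  ~ (isint (XC p) /\ isint (YC p)) -> g = id /\ (forall u, wl k u = u).
Proof.
move=> [b [c hg]] ok e np.
have eX := congr1 XC e; have eY := congr1 YC e.
move: eX eY; rewrite hg !coordD => eX eY.
case: k ok hg eX eY => //= _ hg eX eY.
- split; last exact: wl1.
  have t0 : tr b c = 0 by apply: (addrI p); rewrite addr0 -[RHS]e hg wl1.
  by apply/funext => q; rewrite hg wl1 t0 addr0.
- case: np; split; [exists c|exists (b + c)];
    move: eX eY; rewrite !(intrD, intrM, intrN, mulrNz, mulrzBr); lra.
- case: np; split; [exists (b + 2 * c)|exists (- c)];
    move: eX eY; rewrite !(intrD, intrM, intrN, mulrNz, mulrzBr); lra.
Qed.

(** Two elements of the same parity that agree at p differ by an even element
    that fixes p. *)
Lemma inW_eq k k' g g' p : inW k g -> inW k' g' -> odd_weyl k = odd_weyl k' ->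
  g p = g' p -> ~ (isint (XC p) /\ isint (YC p)) ->
  g = g' /\ (forall u, wl k u = wl k' u).
Proof.
move=> hg hg' ok e np.
have [k1 [g1 [ o1 l1 h1 gK1]]] := inW_inv hg'.
have [k2 [ o2 l2 h2]] := inW_comp h1 hg.
have [e2 e3] : g1 \o g = id /\ forall u, wl k2 u = u.
  apply: (inW_fix h2 _ _ np) => /=; last by rewrite e gK1.
  by rewrite o2 o1 ok addbb.
suff eg : g = g' by split=> // u; apply: (inW_lin hg); rewrite eg.
apply/funext => q; apply: (inW_inj h1); rewrite gK1.
exact: (congr1 (@^~ q) e2).
Qed.

(** A translation or a rotation moves the unit square of the lattice around p
    so that one half of it becomes the triangle; the other half needs one more
    reflection. *)
Lemma inW_cover p : exists k g, inW k g /\ table s (g p).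
Proof.
(* m, n: the unit square of the lattice containing p; the residue of m - n
   modulo 3 tells which vertex of the triangle its corner folds onto. *)
pose m := Num.floor (XC p); pose n := Num.floor (YC p).
have [hm1 hm2] : m%:~R <= XC p /\ XC p < m%:~R + 1.
  by have /andP[] := Num.Theory.floor_itv (XC p); rewrite intrD.
have [hn1 hn2] : n%:~R <= YC p /\ YC p < n%:~R + 1.
  by have /andP[] := Num.Theory.floor_itv (YC p); rewrite intrD.
have W k b c : table s (wl k p + tr b c) -> exists k g, inW k g /\ table s (g p).
  by move=> h; exists k, (fun p => wl k p + tr b c); split=> //; exists b, c.
have [c hc] : exists c, m = n + 3 * c \/ m = n + 3 * c + 1 \/ m = n + 3 * c + 2.
  exists ((m - n) %/ 3)%Z.
  lia.
clearbody m n.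
have [up|dn] := lerP (XC p + YC p) (m%:~R + n%:~R + 1).
  case: hc => [|[]] hc.
  - apply: (W WId (- n) (- c)).
    by apply/(tableE s_gt0); rewrite !coordD /= {}hc in hm1 hm2 up *; split; lra.
  - apply: (W WRot (- m) (n + 2 * c + 1)).
    by apply/(tableE s_gt0); rewrite !coordD /= {}hc in hm1 hm2 up *; split; lra.
  - apply: (W WRotV (1 + m + n) (- 1 - n - c)).
    by apply/(tableE s_gt0); rewrite !coordD /= {}hc in hm1 hm2 up *; split; lra.
case: hc => [|[]] hc.
- apply: (W WRef1 (m + 1) (- c)).
  by apply/(tableE s_gt0); rewrite !coordD /= {}hc in hm1 hm2 dn *; split; lra.
- apply: (W WRef0 (n + 1) (- n - c - 1)).
  by apply/(tableE s_gt0); rewrite !coordD /= {}hc in hm1 hm2 dn *; split; lra.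
- apply: (W WRef2 (- m - n - 1) (n + 2 * c + 2)).
  by apply/(tableE s_gt0); rewrite !coordD /= {}hc in hm1 hm2 dn *; split; lra.
Qed.

End UnfoldingGroup.

(** * The lines and nodes of the tiling *)

Section Tiling.
Variables (R : realType) (s : R).
Hypothesis s_gt0 : 0 < s.
Implicit Types (p q u v d z : 'rV[R]_2) (k : weyl) (g : 'rV[R]_2 -> 'rV[R]_2).

Local Notation XC := (coordX s).
Local Notation YC := (coordY s).
Local Notation pt := (at_coords s).
Local Notation rate := (side_rate s).
Local Notation bar := (barycentric s).
Local Notation NC := (sqnorm s).
Local Notation wl := (weyl_act s).
Local Notation tr := (lattice_shift s).
Local Notation inW := (unfolding_elt s).
Local Notation coordD := (coord_rules s_gt0).
Local Notation cinj := (coord_inj s_gt0).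

Definition is_node p := isint (XC p) /\ isint (YC p).
Local Notation isnode := is_node.
(** The lines of the tiling are those on which a rate is an integer; this
    holds for each of the three families. *)
Definition on_tiling p := exists i, isint (rate i p).
Local Notation on_lines := on_tiling.

Lemma tile_edge_reflection p q : tile_edge s p q ->
  exists k, [/\ odd_weyl k, inW k (reflect_line p q) &
    forall z, segment p q z -> reflect_line p q z = z].
Proof.
case=> i [j pq].
have [a [b [k [b0 [c0 [-> -> ok dN hk]]]]]] : exists (a b : 'rV[R]_2) (k : weyl) (b0 c0 : int),
    [/\ p = a, q = a + b, odd_weyl k, NC b = 1 & forall z,
      a + ((2 * XC (z - a) * XC b + 2 * YC (z - a) * YC b +
         (XC (z - a) * YC b + YC (z - a) * XC b)) *: b - (z - a)) =
      wl k z + tr b0 c0].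
  case: pq => -[-> ->]; rewrite !node_pt //.
  - exists (pt i%:~R j%:~R), (pt 1 0), WRef0, (2 * j), (- j); split=> //.
    + by apply: cinj; rewrite !coordD; ring.
    + by rewrite /sqnorm !coordD; ring.
    + by move=> z; apply: cinj; rewrite !coordD /=; field.
  - exists (pt i%:~R j%:~R), (pt 0 1), WRef2, (- i), i; split=> //.
    + by apply: cinj; rewrite !coordD; ring.
    + by rewrite /sqnorm !coordD; ring.
    + by move=> z; apply: cinj; rewrite !coordD /=; field.
  - exists (pt (i + 1)%:~R j%:~R), (pt (- 1) 1), WRef1, (i + j + 1), 0; split=> //.
    + by apply: cinj; rewrite !coordD; ring.
    + by rewrite /sqnorm !coordD; ring.
    + by move=> z; apply: cinj; rewrite !coordD /=; field.
have rE z : reflect_line a (a + b) z = wl k z + tr b0 c0.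
  by rewrite /reflect_line (addrC a b) addrK (mirrorE s_gt0 _ dN) hk.
exists k; split=> //; first by exists b0, c0.
move=> z [x _ ->]; rewrite {2 3}(addrC a b) !addrK rE -hk (addrAC a) subrr add0r.
have -> : 2 * XC (x *: b) * XC b + 2 * YC (x *: b) * YC b +
   (XC (x *: b) * YC b + YC (x *: b) * XC b) = 2 * x.
  transitivity (2 * x * NC b); last by rewrite dN mulr1.
  by rewrite !coordD /sqnorm; ring.
by rewrite -scalerBl; congr (_ + _ *: _); ring.
Qed.

Lemma on_lines_edge z : on_lines z -> exists p q, tile_edge s p q /\ segment p q z.
Proof.
have fl (x : R) : exists m : int, m%:~R <= x /\ x < m%:~R + 1.
  by exists (Num.floor x); have /andP[] := Num.Theory.floor_itv x; rewrite intrD.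
case; elim/ord3_ind=> -[m]; rewrite /side_rate /= => hm.
- have [n [n1 n2]] := fl (XC z); exists (node s n m), (node s (n + 1) m).
  split; first by exists n, m; constructor 1.
  exists (XC z - n%:~R); first by apply/andP; split; lra.
  by rewrite !node_pt //; apply: cinj; rewrite !coordD; lra.
- have [n [n1 n2]] := fl (YC z); exists (node s (- m - n - 1 + 1) n), (node s (- m - n - 1) (n + 1)).
  split; first by exists (- m - n - 1), n; constructor 3.
  exists (YC z - n%:~R); first by apply/andP; split; lra.
  by rewrite !node_pt //; apply: cinj; rewrite !coordD; lra.
- have [n [n1 n2]] := fl (YC z); exists (node s m n), (node s m (n + 1)).
  split; first by exists m, n; constructor 2.
  exists (YC z - n%:~R); first by apply/andP; split; lra.
  by rewrite !node_pt //; apply: cinj; rewrite !coordD; lra.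
Qed.

Lemma isint_tr i b c : isint (rate i (tr b c)).
Proof.
elim/ord3_ind: i; rewrite /side_rate /= !coordD; [exists b|exists (- b - 3 * c - b)|exists (b + 3 * c)]; ring.
Qed.

Lemma isint_signD (e : bool) (x y : R) : isint y ->
  isint ((if e then -1 else 1) * x + y) <-> isint x.
Proof.
move=> hy; split=> [h|h].
  have := isintD h (isintN hy); rewrite addrK; case: e {h}; rewrite ?mul1r // mulN1r.
  by move/isintN; rewrite opprK.
by apply: isintD => //; case: e; rewrite ?mul1r // mulN1r; exact: isintN.
Qed.

(** Families of lines go to families of lines, with integer positions
    preserved since translations have integer coordinates. *)
Lemma inW_rate k g i : inW k g -> exists j,
  (forall u, rate i (wl k u) = (if odd_weyl k then -1 else 1) * rate j u) /\
  forall p, isint (rate i (g p)) <-> isint (rate j p).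
Proof.
case=> b [c hg]; have [j hj] := wl_rate s_gt0 k i; exists j; split=> // p.
by rewrite hg rateD // hj; exact/isint_signD/isint_tr.
Qed.

Lemma on_lines_inW k g p : inW k g -> on_lines (g p) <-> on_lines p.
Proof.
move=> hg.
have imp k' g' q : inW k' g' -> on_lines (g' q) -> on_lines q.
  by move=> hg' [i]; have [j [_ hj]] := inW_rate i hg' => /hj; exists j.
split; first exact: imp hg.
by have [k' [g' [_ _ hg' gK]]] := inW_inv s_gt0 hg => h; apply: imp hg' _; rewrite gK.
Qed.

Lemma isnode_inW k g p : inW k g -> isnode (g p) <-> isnode p.
Proof.
move=> hg.
have imp k' g' q : inW k' g' -> isnode q -> isnode (g' q).
  case=> b [c hg'] [hx hy]; rewrite /isnode hg' !coordD; split; apply: isintD; try exact: isint_int.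
    by case: k' {hg'} => /=; do ?[done|apply: isintN|apply: isintD].
  by case: k' {hg'} => /=; do ?[done|apply: isintN|apply: isintD].
split; last exact: imp hg.
by have [k' [g' [_ _ hg' gK]]] := inW_inv s_gt0 hg => h; rewrite -(gK p); apply: imp hg' _.
Qed.

Lemma isnode_rates i j p : i != j -> isint (rate i p) -> isint (rate j p) -> isnode p.
Proof.
suff H : isint (rate 0 p) /\ isint (rate 1 p) \/ isint (rate 0 p) /\ isint (rate 2 p) \/
    isint (rate 1 p) /\ isint (rate 2 p) -> isnode p.
  by elim/ord3_ind: i; elim/ord3_ind: j => // _ h1 h2; apply: H; tauto.
rewrite /side_rate /isnode /=.
case=> [[[m hm] [n hn]]|[[[m hm] [n hn]]|[[m hm] [n hn]]]].
- by split; [exists (- m - n); rewrite intrD !mulrNz; lra|exists m].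
- by split; [exists n|exists m].
- by split; [exists n|exists (- m - n); rewrite intrD !mulrNz; lra].
Qed.

Lemma boundaryE p : table s p -> boundary s p <-> on_lines p.
Proof.
move=> tp; have /(tableE s_gt0)[x0 y0 xy1] := tp; split.
  case=> i /(sideP s_gt0)[_]; elim/ord3_ind: i; rewrite /barycentric /= => h.
  - by exists 0, 0.
  - by exists 1, (-1); rewrite /side_rate /=; lra.
  - by exists 2, 0.
suff H : (YC p = 0 \/ 1 - XC p - YC p = 0 \/ XC p = 0) -> boundary s p.
  have H1 (x : R) : isint x -> 0 <= x <= 1 -> x = 0 \/ x = 1.
    case=> m -> /andP[h1 h2]; rewrite !(ler_int R 0, ler_int R _ 1) in h1 h2.
    have [em|em] : m = 0 \/ m = 1 by lia.
      by left; rewrite em.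
    by right; rewrite em.
  case; elim/ord3_ind; rewrite /side_rate /= => h.
  - by case: (H1 _ h _) => [|e|e]; [apply/andP; split; lra|apply: H; left|
      apply: H; right; right; lra].
  - by case: (H1 _ (isintN h) _) => [|e|e]; [apply/andP; split; lra|
      apply: H; left; lra|apply: H; right; left; lra].
  - by case: (H1 _ h _) => [|e|e]; [apply/andP; split; lra|
      apply: H; right; right|apply: H; left; lra].
case=> [e|[e|e]]; [exists 0|exists 1|exists 2]; exact/(sideP s_gt0).
Qed.

Lemma vertex_isnode p : table s p -> isnode p <-> exists i, p = vertex s i.
Proof.
have [v0 v1 v2] := vertexE s.
move=> tp; have /(tableE s_gt0)[x0 y0 xy1] := tp; split.
  case=> -[m hm] [n hn].
  have m0 : 0 <= m by rewrite -(ler_int R) -hm.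
  have n0 : 0 <= n by rewrite -(ler_int R) -hn.
  have mn : m + n <= 1 by rewrite -(ler_int R) intrD -hm -hn.
  have [[em en]|[[em en]|[em en]]] : m = 0 /\ n = 0 \/ m = 1 /\ n = 0 \/ m = 0 /\ n = 1 by lia.
  - by exists 1; rewrite v1; apply: cinj; rewrite !coordD ?hm ?hn ?em ?en.
  - by exists 2; rewrite v2; apply: cinj; rewrite !coordD ?hm ?hn ?em ?en.
  - by exists 0; rewrite v0; apply: cinj; rewrite !coordD ?hm ?hn ?em ?en.
case; elim/ord3_ind=> ->; rewrite ?v0 ?v1 ?v2 /isnode !coordD.
- by split; [exists 0|exists 1].
- by split; exists 0.
- by split; [exists 1|exists 0].
Qed.

Lemma side_reflection i : exists k g, [/\ odd_weyl k, inW k g,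
  forall p, bar i p = 0 -> g p = p & forall u, wl k u = mirror (side_dir s i) u].
Proof.
have K k j : (forall u, rate 0 (wl k u) = rate 0 u + (if 0 == j then - 2 else 1) * rate j u) ->
   (forall u, rate 2 (wl k u) = rate 2 u + (if 2 == j then - 2 else 1) * rate j u) ->
   forall u, wl k u = mirror (side_dir s j) u.
  by move=> h0 h2 u; apply: cinj; [have := h2 u|have := h0 u]; rewrite -rate_mirror.
elim/ord3_ind: i; [exists WRef0, (fun p => wl WRef0 p + tr 0 0)
  |exists WRef1, (fun p => wl WRef1 p + tr 1 0)|exists WRef2, (fun p => wl WRef2 p + tr 0 0)];
  (split=> //; [by do 2!eexists
   |by move=> p; rewrite /barycentric /= => e; apply: cinj; rewrite !coordD /=; lra
   |by apply: K => u; rewrite /side_rate /= !coordD /=; ring]).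
Qed.

End Tiling.

(** * Unfolding a trajectory *)

(** Continuous induction. It replaces an induction on the strikes, whose
    discreteness is only a consequence of the unfolding. *)
Lemma real_induction (R : realType) (P : R -> Prop) (a : R) : P a ->
  (forall t, a <= t -> P t -> exists2 e, 0 < e & forall h, 0 <= h < e -> P (t + h)) ->
  (forall t, a < t -> (forall r, a <= r < t -> P r) -> P t) ->
  forall t, a <= t -> P t.
Proof.
move=> Pa Po Pc t1 t1a; apply: contrapT => nP.
pose S := [set t | a <= t /\ ~ P t].
have Si : has_inf S by split; [exists t1|exists a => t []].
have ma : a <= inf S by apply: lb_le_inf; [exists t1|move=> t []].
have Pbelow r : a <= r < inf S -> P r.
  case/andP=> ar rm; apply: contrapT => nPr.
  by have /(_ r) := ge_inf Si.2; rewrite leNgt rm => /(_ (conj ar nPr)).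
have Pm : P (inf S).
  by move: ma; rewrite le_eqVlt => /predU1P[<-//|am]; apply: Pc.
have [e e0 Pe] := Po _ ma Pm.
suff : inf S + e <= inf S by lra.
apply: lb_le_inf; first by exists t1.
move=> t [ta nPt]; rewrite leNgt; apply/negP => te; apply: nPt.
have [tm|mt] := ltP t (inf S); first by apply: Pbelow; rewrite ta.
by rewrite -(subrKC (inf S) t); apply: Pe; apply/andP; split; lra.
Qed.

Section Trajectory.
Variables (R : realType) (s : R).
Hypothesis s_gt0 : 0 < s.
Implicit Types (p q u v z : 'rV[R]_2) (k : weyl) (g : 'rV[R]_2 -> 'rV[R]_2).
Implicit Types (al : R -> 'rV[R]_2).

Local Notation wl := (weyl_act s).
Local Notation tr := (lattice_shift s).
Local Notation inW := (unfolding_elt s).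
Local Notation isnode := (is_node s).
Local Notation on_lines := (on_tiling s).

Lemma departs_uniq al t u v : departs al t u -> departs al t v -> u = v.
Proof.
case=> e e0 he [f f0 hf]; pose h := Num.min e f / 2.
have m0 : 0 < Num.min e f by rewrite lt_min e0.
have [me mf] : Num.min e f <= e /\ Num.min e f <= f by rewrite !ge_min !lexx orbT.
have h0 : 0 < h by rewrite /h; lra.
have he' := he h _; have hf' := hf h _.
apply: (scalerI (lt0r_neq0 h0)); apply: (addrI (al t)).
by rewrite -he' ?hf' //; apply/andP; rewrite /h; split; lra.
Qed.

Lemma arrives_uniq al t u v : arrives al t u -> arrives al t v -> u = v.
Proof.
move=> hu hv.
have rev w : arrives al t w -> departs (fun t => al (- t)) (- t) (- w).
  case=> e e0 he; exists e => // h hh.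
  by rewrite opprD !opprK he // scalerN.
exact/oppr_inj/(departs_uniq (rev _ hu) (rev _ hv)).
Qed.

Lemma departs_segment al t e v : (forall h, 0 <= h < e -> al (t + h) = al t + h *: v) ->
  forall h, 0 <= h < e -> departs al (t + h) v.
Proof.
move=> he h /andP[h0 h1]; exists (e - h); first by lra.
move=> h' /andP[h2 h3]; rewrite -addrA !he ?scalerDl ?addrA //.
  by apply/andP; split; lra.
by apply/andP; split; lra.
Qed.

Lemma arrives_segment al t e u : (forall h, 0 <= h < e -> al (t - h) = al t - h *: u) ->
  forall h, 0 < h < e -> departs al (t - h) u.
Proof.
move=> he h /andP[h0 h1]; exists h => // h' /andP[h2 h3].
rewrite (_ : t - h + h' = t - (h - h')); last by ring.
rewrite !he; last by apply/andP; split; lra.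
  by rewrite scalerBl opprB addrA addrAC.
by apply/andP; split; lra.
Qed.

Lemma departs_period al T t v : (forall t, al (t + T) = al t) ->
  departs al t v -> departs al (t + T) v.
Proof.
by move=> hT [e e0 he]; exists e => // h hh; rewrite addrAC !hT he.
Qed.

Lemma traj_table al t : nonsingular_trajectory s al -> table s (al t).
Proof. by case=> c c0 /(_ t)[]. Qed.

Lemma traj_nonode al t : nonsingular_trajectory s al -> ~ isnode (al t).
Proof.
move=> tr; have [c c0 /(_ t)[tb nv _]] := tr.
by move/(vertex_isnode s_gt0 tb) => [i]; apply: nv.
Qed.

Lemma traj_velocities al t : nonsingular_trajectory s al ->
  exists u v, [/\ arrives al t u, departs al t v & ~ boundary s (al t) -> v = u].
Proof. by case=> c c0 /(_ t)[_ _ [u [v [[h1 h2] _ h3 _]]]]; exists u, v. Qed.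

Lemma mirrorK i u : mirror (side_dir s i) (mirror (side_dir s i) u) = u.
Proof.
apply: (rate_inj s_gt0) => j; rewrite !rate_mirror // eqxx.
by case: (j == i); ring.
Qed.

Lemma traj_mirror al t i u v : nonsingular_trajectory s al ->
  arrives al t u -> departs al t v -> side s i (al t) -> u = mirror (side_dir s i) v.
Proof.
move=> [c c0 /(_ t)[_ _ [u' [v' [[h1 h2] _ _ h3]]]]] hu hv hi.
by rewrite (arrives_uniq hu h1) (departs_uniq hv h2) (h3 _ hi) mirrorK.
Qed.

Lemma traj_through al t u v : nonsingular_trajectory s al ->
  arrives al t u -> departs al t v -> ~ boundary s (al t) -> v = u.
Proof.
move=> [c c0 /(_ t)[_ _ [u' [v' [[h1 h2] _ h3 _]]]]] hu hv hi.
by rewrite (arrives_uniq hu h1) (departs_uniq hv h2) h3.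
Qed.

(** Passing through the interior is covered by the identity, which makes
    strikes and interior points alike in what follows. *)
Lemma traj_bounce al t u v : nonsingular_trajectory s al ->
  arrives al t u -> departs al t v ->
  exists k g, [/\ inW k g, g (al t) = al t & wl k v = u].
Proof.
move=> tr hu hv; have [[i hi]|nb] := pselect (boundary s (al t)).
  have [k [g [_ hg fg lg]]] := side_reflection s_gt0 i.
  exists k, g; split=> //; first by apply: fg; have /(sideP s_gt0)[] := hi.
  by rewrite lg (traj_mirror tr hu hv hi).
exists WId, id; split; [exact: inW_id|by []|].
by rewrite wl1 //; apply: traj_through tr hu hv nb.
Qed.

(** By continuous induction: along a segment the group element is constant,
    and a strike multiplies it by the reflection in the side struck. *)
Lemma unfolding_line al t0 v : nonsingular_trajectory s al -> departs al t0 v ->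
  forall t, t0 <= t -> exists k g, [/\ inW k g, g (al t) = al t0 + (t - t0) *: v &
     forall v', departs al t v' -> wl k v' = v].
Proof.
move=> tr hv; apply: real_induction.
- exists WId, id; split; [exact: inW_id|by rewrite subrr scale0r addr0|].
  by move=> v' hv'; rewrite wl1 // (departs_uniq hv' hv).
- move=> t _ [k [g [hg gt lk]]].
  have [u1 [v1 [_ hv1 _]]] := traj_velocities t tr.
  have [e e0 he] := hv1; exists e => // h hh; exists k, g; split=> //.
    rewrite he // (inW_add _ _ _ hg) // wlZ // (lk _ hv1) gt -addrA -scalerDl.
    by congr (_ + _ *: _); ring.
  move=> v' hv'; rewrite -(lk _ hv1); congr wl.
  exact: departs_uniq hv' (departs_segment he hh).
move=> t t0t IH.
have [u [v1 [hu hv1 _]]] := traj_velocities t tr.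
have [e e0 he] := hu; pose h := Num.min e (t - t0) / 2.
have m0 : 0 < Num.min e (t - t0) by rewrite lt_min e0 subr_gt0.
have [me mf] : Num.min e (t - t0) <= e /\ Num.min e (t - t0) <= t - t0.
  by rewrite !ge_min !lexx orbT.
have [|k [g [hg gt lk]]] := IH (t - h); first by apply/andP; rewrite /h; split; lra.
have hdu : departs al (t - h) u.
  by apply: (arrives_segment he); apply/andP; rewrite /h; split; lra.
have [k1 [g1 [hg1 g1t lk1]]] := traj_bounce tr hu hv1.
have [k2 [_ lk2 hg2]] := inW_comp s_gt0 hg hg1.
exists k2, (g \o g1); split=> //; last first.
  by move=> v' hv'; rewrite lk2 (departs_uniq hv' hv1) lk1 lk.
rewrite /= g1t; have -> : al t = al (t - h) + h *: u.
  by rewrite he ?subrK //; apply/andP; rewrite /h; split; lra.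
rewrite (inW_add _ _ _ hg) // wlZ // (lk _ hdu) gt -addrA -scalerDl.
by congr (_ + _ *: _); ring.
Qed.

(** The same continuous induction, with the identity throughout. The arrival
    velocity is needed to apply the reflection law at the next strike. *)
Lemma straight_line al c d v : nonsingular_trajectory s al -> departs al c v ->
  c < d -> (forall t, c < t < d -> ~ boundary s (al t)) ->
  al d = al c + (d - c) *: v /\ arrives al d v.
Proof.
move=> tr hv cd nb.
have H t : c <= t -> t < d -> al t = al c + (t - c) *: v /\ departs al t v.
  move: t; apply: real_induction; first by rewrite subrr scale0r addr0.
    move=> t ct IH; have [dt|td] := lerP d t.
      by exists 1 => // h /andP[h0 _] hd; exfalso; lra.
    have [e1 e2] := IH td; have [e e0 he] := e2; exists e => // h hh _.
    split; last exact: (departs_segment he hh).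
    by rewrite he // e1 -addrA -scalerDl; congr (_ + _ *: _); ring.
  move=> t ct IH td.
  have [u [v1 [hu hv1 nbv]]] := traj_velocities t tr.
  have [e e0 he] := hu; pose h := Num.min e (t - c) / 2.
  have m0 : 0 < Num.min e (t - c) by rewrite lt_min e0 subr_gt0.
  have [me mf] : Num.min e (t - c) <= e /\ Num.min e (t - c) <= t - c.
    by rewrite !ge_min !lexx orbT.
  have [e1 e2] : al (t - h) = al c + (t - h - c) *: v /\ departs al (t - h) v.
    by apply: IH; [apply/andP; rewrite /h; split; lra|rewrite /h; lra].
  have hdu : departs al (t - h) u.
    by apply: (arrives_segment he); apply/andP; rewrite /h; split; lra.
  have uv := departs_uniq hdu e2.
  have vv : v1 = v by rewrite nbv //; apply: nb; rewrite ct.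
  split; last by rewrite -vv.
  have -> : al t = al (t - h) + h *: u.
    by rewrite he ?subrK //; apply/andP; rewrite /h; split; lra.
  by rewrite e1 uv -addrA -scalerDl; congr (_ + _ *: _); ring.
have [u [v1 [hu hv1 nbv]]] := traj_velocities d tr.
have [e e0 he] := hu; pose h := Num.min e (d - c) / 2.
have m0 : 0 < Num.min e (d - c) by rewrite lt_min e0 subr_gt0.
have [me mf] : Num.min e (d - c) <= e /\ Num.min e (d - c) <= d - c.
  by rewrite !ge_min !lexx orbT.
have [e1 e2] : al (d - h) = al c + (d - h - c) *: v /\ departs al (d - h) v.
  by apply: H; rewrite /h; lra.
have hdu : departs al (d - h) u.
  by apply: (arrives_segment he); apply/andP; rewrite /h; split; lra.
have uv := departs_uniq hdu e2.
split; last by rewrite -uv.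
have -> : al d = al (d - h) + h *: u.
  by rewrite he ?subrK //; apply/andP; rewrite /h; split; lra.
by rewrite e1 uv -addrA -scalerDl; congr (_ + _ *: _); ring.
Qed.

Lemma strike_iff al t0 v t : nonsingular_trajectory s al -> departs al t0 v ->
  t0 <= t -> boundary s (al t) <-> on_lines (al t0 + (t - t0) *: v).
Proof.
move=> tr hv /(unfolding_line tr hv)[k [g [hg <- _]]].
rewrite (boundaryE s_gt0 (traj_table t tr)).
by rewrite (on_lines_inW s_gt0 _ hg).
Qed.

Lemma line_nonode al t0 v t : nonsingular_trajectory s al -> departs al t0 v ->
  t0 <= t -> ~ isnode (al t0 + (t - t0) *: v).
Proof.
move=> tr hv /(unfolding_line tr hv)[k [g [hg <- _]]].
by rewrite (isnode_inW s_gt0 _ hg); apply: traj_nonode.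
Qed.

End Trajectory.

(** * Holonomy and strikes of an orbit in standard direction *)

Lemma seq_card_eq (T : eqType) (A : set T) (q : seq T) (n : nat) :
  uniq q -> size q = n -> (forall x, x \in q <-> A x) -> (A #= `I_n)%card.
Proof.
case: q => [|x0 q] uq <- qA.
  by rewrite II0 (_ : A = set0) // -subset0 => x /qA.
rewrite (_ : A = nth x0 (x0 :: q) @` `I_(size (x0 :: q))).
  apply: inj_card_eq => i j; rewrite !inE /= => hi hj /eqP.
  by rewrite nth_uniq // => /eqP.
apply/seteqP; split=> [x /qA xq|x [i hi <-]]; last by apply/qA/mem_nth.
exists (index x (x0 :: q)); last exact: nth_index.
by have := xq; rewrite -index_mem.
Qed.

(** The half-open window [a, a + T) corresponds to the half-open interval [c,
    c + r T), whose integers are p, ..., p + N - 1. *)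
Lemma crossing_times (R : realType) (a T r c : R) (p : int) (N : nat) :
  0 < T -> 0 < r -> p%:~R - 1 < c <= p%:~R ->
  p%:~R + N%:R - 1 < c + r * T <= p%:~R + N%:R ->
  exists q : seq R, [/\ uniq q, size q = N &
    forall t, t \in q <-> a <= t < a + T /\ isint (c + r * (t - a))].
Proof.
move=> T0 r0 /andP[c1 c2] /andP[d1 d2].
exists [seq a + (p%:~R + i%:R - c) / r | i <- iota 0 N].
rewrite size_map size_iota map_inj_uniq ?iota_uniq; last first.
  move=> i j /addrI/(mulIf _); rewrite invr_eq0 gt_eqF // => /(_ isT).
  by move=> /addIr/addrI/eqP; rewrite eqr_nat => /eqP.
split=> // t; split.
  case/mapP=> i; rewrite mem_iota /= add0n => iN ->.
  have iN' : i%:R + 1 <= N%:R :> R by rewrite natr1 ler_nat.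
  split; last first.
    exists (p + i); rewrite addrAC subrr add0r mulrC divfK ?gt_eqF // intrD.
    by rewrite -pmulrn; ring.
  have i0 : 0 <= i%:R :> R by [].
  rewrite lerDl ltrD2l divr_ge0 ?(ltW r0) //=; last by lra.
  by rewrite ltr_pdivrMr // (mulrC T); lra.
case=> /andP[at1 at2] [m hm].
have rt : 0 <= r * (t - a) < r * T.
  by rewrite ltr_pM2l // mulr_ge0 ?(ltW r0) ?subr_ge0 //= ltrBlDl.
have /andP[rt1 rt2] := rt.
have pm : p <= m.
  have : (p - 1)%:~R < m%:~R :> R by rewrite -hm intrD; lra.
  by rewrite ltr_int; clear; lia.
have mN : m < p + N.
  by rewrite -(ltr_int R) -hm intrD -pmulrn; lra.
apply/mapP; exists `|m - p|%N; first by move: pm mN; rewrite mem_iota; clear; lia.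
have -> : (`|m - p|%N)%:R = m%:~R - p%:~R :> R.
  by rewrite natr_absz ger0_norm ?subr_ge0 // intrD mulrNz.
rewrite -hm (_ : _ - c = r * (t - a)); last by ring.
by rewrite mulrC mulKf ?gt_eqF // subrKC.
Qed.

Section Standard.
Variables (R : realType) (s : R).
Hypothesis s_gt0 : 0 < s.
Implicit Types (p q u v z : 'rV[R]_2) (k : weyl) (g : 'rV[R]_2 -> 'rV[R]_2).
Implicit Types (al : R -> 'rV[R]_2).

Local Notation XC := (coordX s).
Local Notation YC := (coordY s).
Local Notation pt := (at_coords s).
Local Notation rate := (side_rate s).
Local Notation NC := (sqnorm s).
Local Notation wl := (weyl_act s).
Local Notation tr := (lattice_shift s).
Local Notation coordD := (coord_rules s_gt0).
Local Notation cinj := (coord_inj s_gt0).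

Definition rate_norm u : R := `|XC u| + `|YC u| + `|XC u + YC u|.

Lemma rate_norm_wl k u : rate_norm (wl k u) = rate_norm u.
Proof.
rewrite /rate_norm !coordD; move: (XC u) (YC u) => x y; case: k => /=.
- by [].
- have -> : - x - y + x = - y by ring.
  by rewrite -opprD !normrN; ring.
- have -> : y + (- x - y) = - x by ring.
  by rewrite -opprD !normrN; ring.
- by rewrite addrK normrN; ring.
- by rewrite -opprD !normrN (addrC y); ring.
- by rewrite addKr normrN; ring.
Qed.

(** Reflections only permute the rates, up to sign. *)
Lemma traj_conserved al : nonsingular_trajectory s al ->
  forall t t' v v', departs al t v -> departs al t' v' ->
    rate_norm v = rate_norm v' /\ NC v = NC v'.
Proof.
move=> tr t t' v v' hv hv'.
wlog le : t t' v v' hv hv' / t <= t'.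
  by move=> H; have [/H|/ltW/H H'] := lerP t t'; [exact|case: (H' _ _ hv' hv)].
have [k [g [_ _ /(_ _ hv') <-]]] := unfolding_line s_gt0 tr hv le.
by rewrite rate_norm_wl NC_wl.
Qed.

(** Directions between 30 and 60 degrees above BC. *)
Definition in_cone v := [/\ 0 <= XC v, XC v <= YC v & 0 < YC v].

Lemma rate_norm_cone v : in_cone v -> rate_norm v = 2 * (XC v + YC v).
Proof.
case=> v1 v2 v3; rewrite /rate_norm (ger0_norm v1) (gtr0_norm v3) ger0_norm; lra.
Qed.

(** In the cone the two invariants determine the sum and the product of the
    coordinates, and the cone fixes their order. *)
Lemma in_cone_inj u v : in_cone u -> in_cone v -> rate_norm u = rate_norm v ->
  NC u = NC v -> u = v.
Proof.
move=> cu cv; rewrite !rate_norm_cone //; move: cu cv => [u1 u2 u3] [v1 v2 v3].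
rewrite /sqnorm => h1 h2.
have e1 : XC u + YC u = XC v + YC v by lra.
have e2 : YC u - XC u = YC v - XC v.
  apply/eqP; rewrite -(@eqrXn2 _ 2) ?subr_ge0 //; apply/eqP.
  suff : (XC u + YC u) ^+ 2 = (XC v + YC v) ^+ 2 by nra.
  by rewrite e1.
by apply: cinj; lra.
Qed.

Definition starts_standard al a v := [/\ nonsingular_trajectory s al, side s 0 (al a),
  departs al a v & in_cone v].
Local Notation standard := starts_standard.

Lemma standard_start al a v : standard al a v -> YC (al a) = 0 /\ 0 < XC (al a) < 1.
Proof.
case=> tr /(sideP s_gt0)[/(tableE s_gt0)[x0 y0 xy1]]; rewrite /barycentric /= => y0' _ _.
split=> //; have nn := traj_nonode s_gt0 (t := a) tr.
rewrite !lt_neqAle x0 (_ : _ <= 1) ?andbT; last by lra.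
apply/andP; split; apply/eqP => e; apply: nn; rewrite /is_node y0' -?e ?e.
  by split; exists 0.
by split; [exists 1|exists 0].
Qed.

(** The displacement over one period when the reflections compose to a
    translation, and when they compose to a glide reflection, whose axis is
    then the unfolded Fagnano orbit. *)
Definition even_vector V (m n : nat) := V = pt m%:R (m + 3 * n)%:R.
Definition odd_vector V (j : nat) := V = pt 0 (3 / 2 + 3 * j%:R).

(** The composed reflection over one period fixes the velocity v and moves the
    initial point by T v. In the cone, only the identity and the reflection in
    the direction of side AB can fix v. *)
Lemma standard_holonomy al a v T : standard al a v -> 0 < T ->
  (forall t, al (t + T) = al t) ->
  (exists m n, even_vector (T *: v) m n) \/
  XC (al a) = 1 / 2 /\ exists j, odd_vector (T *: v) j.
Proof.
move=> st T0 hT; have [y0 /andP[x0 x1]] := standard_start st.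
have [tr _ hv [v1 v2 v3]] := st.
have [|k [g [hg]]] := unfolding_line s_gt0 tr hv (t := a + T); first by lra.
rewrite hT (addrC a T) addrK => gV /(_ v).
rewrite (addrC T) => /(_ (departs_period hT hv)) lv.
have TX : 0 <= T * XC v by rewrite mulr_ge0 // ltW.
have TY : 0 < T * YC v by rewrite mulr_gt0.
have TXY : T * XC v <= T * YC v by rewrite ler_wpM2l // ltW.
have [b [c hgE]] := hg; move: gV; rewrite hgE => gV.
have gX := congr1 XC gV; have gY := congr1 YC gV.
have lX := congr1 XC lv; have lY := congr1 YC lv.
move: gX gY lX lY; rewrite !coordD y0; case: k {hg hgE lv gV} => /= gX gY lX lY.
- left.
  have eX : (b + 3 * c)%:~R = T * XC v by lra.
  have eY : b%:~R = T * YC v by lra.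
  have h1 : 0 <= b + 3 * c by rewrite -(ler_int R) eX.
  have h2 : b + 3 * c <= b by rewrite -(ler_int R) eX eY.
  exists (absz (b + 3 * c)), (absz c); apply: cinj; rewrite !coordD -?eX -?eY.
    by rewrite natr_absz ger0_norm.
  by rewrite pmulrn; congr (_%:~R); move: h1 h2; clear; lia.
- by exfalso; lra.
- by exfalso; lra.
- by exfalso; lra.
- by exfalso; lra.
right.
have vX : XC v = 0 by lra.
rewrite vX !mulr0 in gX TX TXY *.
have e1 : b + 3 * c = 1.
  have h1 : 0 < b + 3 * c by rewrite -(ltr_int R); lra.
  have h2 : b + 3 * c < 2 by rewrite -(ltr_int R); lra.
  by move: h1 h2; clear; lia.
have x12 : XC (al a) = 1 / 2 by rewrite e1 in gX; lra.
have eb : b = 1 - 3 * c by move: e1; clear; lia.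
have c0 : c <= 0.
  suff : c < 1 by clear; lia.
  by rewrite -(ltr_int R); move: gY; rewrite x12 eb; lra.
split=> //; exists `|c|%N; apply: cinj; rewrite !coordD; first by rewrite vX mulr0.
rewrite natr_absz ler0_norm // mulrNz; move: gY; rewrite x12 eb; lra.
Qed.

(** Strikes are crossings of the three families of lines by the unfolded
    segment; two families are never crossed at once, since they meet only at
    nodes. *)
Lemma standard_strikes al a v T : standard al a v -> 0 < T ->
  (forall t, al (t + T) = al t) ->
  exists q : seq R, [/\ uniq q,
    forall t, t \in q <-> a <= t < a + T /\ boundary s (al t) &
    (exists m n, even_vector (T *: v) m n /\ size q = 2 * (2 * m + 3 * n))%N \/
    (exists j, odd_vector (T *: v) j /\ size q = 6 * j + 3)%N].
Proof.
move=> st T0 hT; have [y0 /andP[x0 x1]] := standard_start st.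
have [tr _ hv [v1 v2 v3]] := st.
have xn : ~ isint (XC (al a)) by move=> xi; have := isint_small xi; lra.
pose L i := [set t | a <= t < a + T /\ isint (rate i (al a + (t - a) *: v))].
have L0E t : L 0 t <-> a <= t < a + T /\ isint (0 + YC v * (t - a)).
  by rewrite /L /side_rate /= !coordD y0 mulrC.
have L1E t : L 1 t <-> a <= t < a + T /\ isint (XC (al a) + (XC v + YC v) * (t - a)).
  rewrite /L /side_rate /= !coordD y0; split=> -[? /isintN h]; split=> //;
    by move: h; congr isint; ring.
have L2E t : L 2 t <-> a <= t < a + T /\ isint (XC (al a) + XC v * (t - a)).
  by rewrite /L /side_rate /= !coordD mulrC.
suff [q0 [q1 [q2 [[u0 u1 u2] [h0 h1 h2 hs]]]]] : exists q0 q1 q2 : seq R,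
   [/\ uniq q0, uniq q1 & uniq q2] /\ [/\ forall t, t \in q0 <-> L 0 t,
    forall t, t \in q1 <-> L 1 t, forall t, t \in q2 <-> L 2 t &
   (exists m n, even_vector (T *: v) m n /\ size q0 + (size q1 + size q2) = 2 * (2 * m + 3 * n))%N \/
    (exists j, odd_vector (T *: v) j /\ size q0 + (size q1 + size q2) = 6 * j + 3)%N].
  have disj i j t : i != j -> L i t -> L j t -> False.
    move=> ij [/andP[at1 _] h] [_ h'].
    exact: (line_nonode s_gt0 tr hv at1) (isnode_rates ij h h').
  exists (q0 ++ (q1 ++ q2)); split; last by rewrite !size_cat.
    rewrite !cat_uniq u0 u1 u2 /= andbT; apply/andP; split.
      apply/hasPn => t; rewrite mem_cat => /orP[/h1 l|/h2 l]; apply/negP => /h0 l'.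
        exact: disj l' l.
      exact: disj l' l.
    by apply/hasPn => t /h2 l; apply/negP => /h1 l'; exact: disj l' l.
  move=> t; rewrite !mem_cat; split.
    have li i : L i t -> a <= t < a + T /\ boundary s (al t).
      move=> [ht h]; split=> //; apply/(strike_iff s_gt0 tr hv); last by exists i.
      by case/andP: ht.
    by case/orP=> [/h0/li|/orP[/h1/li|/h2/li]].
  case=> ht /(strike_iff s_gt0 tr hv); case/andP: (ht) => at1 _ /(_ at1)[i hi].
  have : L i t by [].
  by elim/ord3_ind: i {hi} => [/h0|/h1|/h2] ->; rewrite ?orbT.
have vXY : 0 < XC v + YC v by lra.
case: (standard_holonomy st T0 hT) => [[m [n hV]]|[x12 [j hV]]].
  have eX : XC v * T = m%:R by rewrite mulrC -(XCZ s) hV XC_pt.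
  have eY : YC v * T = (m + 3 * n)%:R by rewrite mulrC -(YCZ s) hV YC_pt.
  have [q0 [u0 s0 h0]] := @crossing_times R a T (YC v) 0 0 (m + 3 * n) T0 v3
     ltac:(apply/andP; split; lra) ltac:(rewrite eY; apply/andP; split; lra).
  have [q1 [u1 s1 h1]] := @crossing_times R a T (XC v + YC v) (XC (al a)) 1 (2 * m + 3 * n) T0 vXY
     ltac:(apply/andP; split; lra)
     ltac:(rewrite mulrDl eX eY !(natrD, natrM); apply/andP; split; lra).
  have [q2 [u2 s2 h2]] : exists q2 : seq R, [/\ uniq q2, size q2 = m & forall t, t \in q2 <-> L 2 t].
    case: (posnP m) => [m0|m0].
      exists [::]; split=> // t; split=> // /L2E[_].
      move: eX; rewrite m0 => /eqP; rewrite mulf_eq0 (gt_eqF T0) orbF => /eqP ->.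
      by rewrite mul0r addr0 => /xn.
    have vX : 0 < XC v.
      by rewrite -(pmulr_lgt0 _ T0) eX ltr0n.
    have [q2 [u2 s2 h2]] := @crossing_times R a T (XC v) (XC (al a)) 1 m T0 vX
     ltac:(apply/andP; split; lra)
     ltac:(rewrite eX; apply/andP; split; lra).
    by exists q2; split=> // t; rewrite h2 L2E.
  exists q0, q1, q2; split=> //; split=> //.
  - by move=> t; rewrite h0 L0E.
  - by move=> t; rewrite h1 L1E.
  - by left; exists m, n; split=> //; rewrite s0 s1 s2; clear; lia.
have eX : XC v * T = 0 by rewrite mulrC -(XCZ s) hV XC_pt.
have eY : YC v * T = 3 / 2 + 3 * j%:R by rewrite mulrC -(YCZ s) hV YC_pt.
have [q0 [u0 s0 h0]] := @crossing_times R a T (YC v) 0 0 (3 * j + 2) T0 v3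
   ltac:(apply/andP; split; lra)
   ltac:(rewrite eY !(natrD, natrM); apply/andP; split; lra).
have [q1 [u1 s1 h1]] := @crossing_times R a T (XC v + YC v) (XC (al a)) 1 (3 * j + 1) T0 vXY
   ltac:(apply/andP; split; lra)
   ltac:(rewrite mulrDl eX eY x12 !(natrD, natrM); apply/andP; split; lra).
exists q0, q1, [::]; split=> //; split=> //.
- by move=> t; rewrite h0 L0E.
- by move=> t; rewrite h1 L1E.
- move=> t; split=> // /L2E[_].
  move: eX => /eqP; rewrite mulf_eq0 (gt_eqF T0) orbF => /eqP ->.
  by rewrite mul0r addr0 => /xn.
by right; exists j; split=> //; rewrite s0 s1 /=; clear; lia.
Qed.

End Standard.

(** * Angles and time windows *)

Section Angles.
Variable R : realType.

Lemma cos_pi3 : cos (pi / 3 : R) = 1 / 2.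
Proof.
have p0 : 0 < pi :> R := pi_gt0 R.
have cgt : 0 < cos (pi / 3 : R) by apply: cos_gt0_pihalf; apply/andP; split; lra.
have : cos (pi / 3 + (pi / 3 + pi / 3) : R) = - 1 by rewrite -(cospi R); congr cos; field.
move: cgt => /[swap].
rewrite !(cosD, sinD); have := cos2Dsin2 (pi / 3 : R).
move: (cos _) (sin _) => c sn e1 e2 cgt.
have e3 : sn ^+ 2 = 1 - c ^+ 2 by lra.
have e4 : c * (c ^+ 2 - sn ^+ 2) - 2 * c * sn ^+ 2 = - 1 by rewrite -e2; ring.
(* the triple angle formula at cos pi = -1 *)
have : (c + 1) * (2 * c - 1) ^+ 2 = 0.
  rewrite e3 in e4; transitivity (c * (c ^+ 2 - (1 - c ^+ 2)) - 2 * c * (1 - c ^+ 2) + 1).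
    by ring.
  by rewrite e4; ring.
move/eqP; rewrite mulf_eq0 expf_eq0 /= => /orP[]/eqP; lra.
Qed.

Lemma cos_pi6_sq : cos (pi / 6 : R) ^+ 2 = 3 / 4.
Proof.
have := cos_pi3; rewrite (_ : pi / 3 = pi / 6 + pi / 6); last by field.
by rewrite cosD; have := cos2Dsin2 (pi / 6 : R); nra.
Qed.

Lemma acos_30_60 (x : R) : 0 <= x <= 1 ->
  (pi / 6 <= acos x <= pi / 3) = (1 / 4 <= x ^+ 2 <= 3 / 4).
Proof.
move=> /andP[x0 x1]; have p0 : 0 < pi :> R := pi_gt0 R.
have c0 : 0 < cos (pi / 6 : R) by apply: cos_gt0_pihalf; apply/andP; split; lra.
have c6 := cos_pi6_sq.
have ax : acos x \in `[0, pi].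
  by rewrite in_itv /= acos_ge0 ?acos_lepi //; apply/andP; split; lra.
have xk : cos (acos x) = x by apply: acosK; rewrite in_itv /=; apply/andP; split; lra.
have lec (y z : R) : 0 <= y <= pi -> 0 <= z <= pi -> (y <= z) = (cos z <= cos y).
  by move=> hy hz; rewrite !leNgt ltr_cos // in_itv.
have ax' : 0 <= acos x <= pi by rewrite in_itv in ax.
have h6 : (pi / 6 <= acos x) = (x <= cos (pi / 6)).
  by rewrite lec ?xk //; apply/andP; split; lra.
have h3 : (acos x <= pi / 3) = (1 / 2 <= x).
  by rewrite lec ?xk ?cos_pi3 //; apply/andP; split; lra.
rewrite h6 h3 andbC -c6; congr andb.
  have -> : 1 / 4 = (1 / 2) ^+ 2 :> R by field.
  by rewrite ler_sqr // nnegrE.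
by rewrite ler_sqr // nnegrE ltW.
Qed.

End Angles.

Section Windows.
Variable R : realType.
Implicit Types (S : set R) (a b t T : R).
Local Open Scope card_scope.

(** The injection reduces times modulo T into the second window. *)
Lemma card_window (S S' : set R) (e : bool) a b T : 0 < T ->
  (forall t, S t -> S' ((-1) ^+ e * t)) -> (forall (m : int) t, S' t -> S' (t + m%:~R * T)) ->
  [set t | a <= t < a + T /\ S t] #<= [set t | b <= t < b + T /\ S' t].
Proof.
move=> T0 SS' hT; pose m t : int := Num.floor (((-1) ^+ e * t - b) / T).
pose f t := (-1) ^+ e * t - (m t)%:~R * T.
have fI : {in [set t | a <= t < a + T /\ S t] &, injective f}.
  move=> t u; rewrite !inE /= => -[/andP[t1 t2] _] [/andP[u1 u2] _] ef.
  have d : (-1) ^+ e * (t - u) = (m t - m u)%:~R * T.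
    by move: ef; rewrite /f intrB; lra.
  have mz : m t - m u = 0.
    have : `|(m t - m u)%:~R * T| < T.
      by rewrite -d normrM normrX normrN1 expr1n mul1r ltr_norml; apply/andP; split; lra.
    rewrite normrM (gtr0_norm T0) gtr_pMl // -intr_norm -[1]/(1%:~R) ltr_int.
    by clear; lia.
  move: d; rewrite mz mul0r => /eqP; rewrite mulf_eq0 signr_eq0 /= subr_eq0.
  by move/eqP.
have := inj_card_eq fI; rewrite card_eq_sym card_eq_le => /andP[/card_le_trans + _]; apply.
apply: subset_card_le => _ [t [ht St] <-] /=; split; last first.
  by rewrite /f -mulNr -mulrNz; apply: hT; apply: SS'.
have /andP[] := Num.Theory.floor_itv (((-1) ^+ e * t - b) / T).
rewrite -/(m t) intrD ler_pdivlMr // ltr_pdivrMr // mulrDl mul1r /f => h1 h2.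
by apply/andP; split; lra.
Qed.

End Windows.

(** * Relabelling, reversal and change of initial point *)

Section Symmetry.
Variables (R : realType) (s : R).
Hypothesis s_gt0 : 0 < s.
Implicit Types (p q u v z : 'rV[R]_2) (k : weyl) (f : 'rV[R]_2 -> 'rV[R]_2).
Implicit Types (al : R -> 'rV[R]_2).

Local Notation rate := (side_rate s).
Local Notation bar := (barycentric s).
Local Notation NC := (sqnorm s).
Local Notation tr := (lattice_shift s).
Local Notation coordD := (coord_rules s_gt0).

Lemma NC_enorm u v : enorm u = enorm v <-> NC u = NC v.
Proof.
have s2 : s ^+ 2 != 0 by rewrite expf_neq0 // gt_eqF.
split=> [e|e]; first by apply: (mulfI s2); rewrite -!(enorm_sq s_gt0) e.
by rewrite /enorm !(dotE s_gt0); congr Num.sqrt; congr (_ * _); move: e; rewrite /sqnorm; lra.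
Qed.

(** A point is determined by its distances to the vertices, in fact its
    barycentric coordinates are affine functions of their squares. *)
Lemma symmetry_bar f : triangle_symmetry s f ->
  exists sg : 'S_3, forall i p, bar (sg i) (f p) = bar i p.
Proof.
case=> iso [sg hsg]; exists sg => i p.
have [v0 v1 v2] := vertexE s.
have D j q : bar j q =
    (1 + (\sum_l NC (q - vertex s l)) - 3 * NC (q - vertex s j)) / 3.
  by rewrite sum3 v0 v1 v2; elim/ord3_ind: j; rewrite /barycentric /sqnorm /= ?v0 ?v1 ?v2 !coordD; field.
have dist l : NC (f p - vertex s (sg l)) = NC (p - vertex s l).
  by apply/NC_enorm; rewrite -hsg iso.
rewrite !D (reindex_inj (@perm_inj _ sg)) dist /=.
by under eq_bigr do rewrite dist.
Qed.

Section Fixed.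
Variables (f : 'rV[R]_2 -> 'rV[R]_2) (sg : 'S_3).
Hypothesis iso : forall x y, enorm (f x - f y) = enorm (x - y).
Hypothesis fbar : forall i p, bar (sg i) (f p) = bar i p.

Definition symlin u := f u - f 0.

Lemma symlin_rate i u : rate (sg i) (symlin u) = rate i u.
Proof.
have := fbar i u; have := fbar i 0; rewrite !barE //.
have r0 : rate i 0 = 0 by rewrite -(scale0r 0) rateZ // mul0r.
by rewrite /symlin rateD // rateN // r0; lra.
Qed.

Lemma perm_surj (P : 'I_3 -> Prop) : (forall i, P (sg i)) -> forall i, P i.
Proof. by move=> h i; rewrite -(permKV sg i). Qed.

Lemma symmetry_affine p h u : f (p + h *: u) = f p + h *: symlin u.
Proof.
apply: (bar_inj s_gt0); apply: perm_surj => i.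
by rewrite barD // !fbar barD // !rateZ // symlin_rate.
Qed.

Lemma enorm_symlin u : enorm (symlin u) = enorm u.
Proof. by rewrite iso subr0. Qed.

Lemma rate_normE u : rate_norm s u = \sum_i `|rate i u|.
Proof.
rewrite sum3 /rate_norm /side_rate /= -opprD normrN; ring.
Qed.

Lemma rate_norm_symlin u : rate_norm s (symlin u) = rate_norm s u.
Proof.
rewrite !rate_normE (reindex_inj (@perm_inj _ sg)) /=.
by under eq_bigr do rewrite symlin_rate.
Qed.

Lemma symmetry_table p : table s (f p) <-> table s p.
Proof.
rewrite !(tableP s_gt0); split=> h; first by move=> i; rewrite -fbar.
by apply: perm_surj => i; rewrite fbar.
Qed.

Lemma symmetry_side i p : side s (sg i) (f p) <-> side s i p.
Proof. by rewrite !(sideP s_gt0) symmetry_table fbar. Qed.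

Lemma symmetry_boundary p : boundary s (f p) <-> boundary s p.
Proof.
split=> -[i]; last by move=> /symmetry_side; exists (sg i).
by move: i; apply: perm_surj => i /symmetry_side; exists i.
Qed.

Lemma symmetry_vertex i p : f p = vertex s (sg i) -> p = vertex s i.
Proof.
move=> e; apply: (bar_inj s_gt0) => j.
by rewrite -fbar e !bar_vertex // (inj_eq perm_inj).
Qed.

Lemma symmetry_mirror i u :
  symlin (mirror (side_dir s i) u) = mirror (side_dir s (sg i)) (symlin u).
Proof.
apply: (rate_inj s_gt0); apply: perm_surj => j.
by rewrite symlin_rate !rate_mirror // !symlin_rate (inj_eq perm_inj).
Qed.

Lemma symmetry_departs al t v : departs al t v -> departs (f \o al) t (symlin v).
Proof. by case=> e e0 he; exists e => // h hh /=; rewrite he // symmetry_affine. Qed.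

Lemma symmetry_arrives al t v : arrives al t v -> arrives (f \o al) t (symlin v).
Proof.
by case=> e e0 he; exists e => // h hh /=; rewrite he // -scaleNr symmetry_affine scaleNr.
Qed.

Lemma symmetry_trajectory al : nonsingular_trajectory s al ->
  nonsingular_trajectory s (f \o al).
Proof.
case=> c c0 tr; exists c => // t; have [tb nv [u [v [[hu hv] [nu nv'] thr mir]]]] := tr t.
split; first exact/symmetry_table.
  by apply: perm_surj => i /symmetry_vertex; apply: nv.
exists (symlin u), (symlin v); split.
- by split; [exact: symmetry_arrives|exact: symmetry_departs].
- by rewrite !enorm_symlin.
- by move=> nb; rewrite thr // => /symmetry_boundary.
by apply: perm_surj => i /symmetry_side /mir ->; exact: symmetry_mirror.
Qed.

End Fixed.

Lemma departs_reverse al t u : arrives al (- t) u -> departs (fun r => al (- r)) t (- u).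
Proof. by case=> e e0 he; exists e => // h hh; rewrite opprD he // scalerN. Qed.

Lemma arrives_reverse al t v : departs al (- t) v -> arrives (fun r => al (- r)) t (- v).
Proof. by case=> e e0 he; exists e => // h hh; rewrite opprB addrC he // scalerN opprK. Qed.

Lemma mirrorN d u : mirror d (- u) = - mirror d u.
Proof.
have e : dot (- u) d = - dot u d.
  by rewrite /dot -sumrN; apply: eq_bigr => j _; rewrite mxE mulNr.
by rewrite /mirror e mulrN mulNr scaleNr opprB opprK addrC.
Qed.

Lemma enormN u : enorm (- u) = enorm u.
Proof. by apply/NC_enorm; rewrite /sqnorm !coordD; ring. Qed.

Lemma reverse_trajectory al : nonsingular_trajectory s al ->
  nonsingular_trajectory s (fun t => al (- t)).
Proof.
move=> tr; have [c c0 h] := tr; exists c => // t.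
have [tb nv [u [v [[hu hv] [nu nv'] thr mir]]]] := h (- t).
split=> //; exists (- v), (- u); split.
- by split; [exact: arrives_reverse|exact: departs_reverse].
- by rewrite !enormN.
- by move=> /thr ->.
by move=> i hi; rewrite mirrorN (traj_mirror s_gt0 tr hu hv hi).
Qed.

Lemma periodic_shift o t : periodic_orbit s o ->
  curve o (t + (stop o - start o)) = curve o t.
Proof.
case=> _ _ h; have := h (t - start o).
by rewrite subrKC => ->; congr curve; ring.
Qed.

Lemma periodic_shiftz o (m : int) t : periodic_orbit s o ->
  curve o (t + m%:~R * (stop o - start o)) = curve o t.
Proof.
move=> po; have nat_case n x : curve o (x + n%:R * (stop o - start o)) = curve o x.
  elim: n x => [|n IH] x; first by rewrite mul0r addr0.
  by rewrite -natr1 mulrDl mul1r addrA periodic_shift.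
case: m => n; first exact: nat_case.
by rewrite NegzE mulrNz mulNr -[LHS](nat_case n.+1) subrK.
Qed.

Lemma normalization_duration o o' : normalization s o o' ->
  stop o' - start o' = stop o - start o.
Proof. by case=> f [[] [c [_ ->]]] /=; ring. Qed.

Lemma normalization_periodic o o' : periodic_orbit s o -> normalization s o o' ->
  periodic_orbit s o'.
Proof.
move=> po no; have du := normalization_duration no.
have [tr lt _] := po; case: no du => f [e [c [sf ->]]] /=.
have [sg fb] := symmetry_bar sf; have [iso _] := sf => du; split.
- case: e {du}; rewrite /relabel /=; last exact: (symmetry_trajectory iso fb tr).
  exact: (symmetry_trajectory iso fb (reverse_trajectory tr)).
- by rewrite -subr_gt0 du subr_gt0.
move=> t /=; congr f; case: e {du} => /=.
  by rewrite -[RHS](periodic_shift _ po); congr curve; ring.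
by rewrite -[LHS](periodic_shift _ po); congr curve; ring.
Qed.

Lemma normalization_period o o' m : periodic_orbit s o -> normalization s o o' ->
  has_period s o m <-> has_period s o' m.
Proof.
move=> po no; have du := normalization_duration no.
have po' := normalization_periodic po no.
have [_ lt _] := po; have T0 : 0 < stop o - start o by rewrite subr_gt0.
have [e he] : exists e : bool, forall t,
    boundary s (curve o' ((-1) ^+ e * t)) <-> boundary s (curve o t).
  case: no => f [e [c [sf ->]]]; exists e => t /=.
  have [sg fb] := symmetry_bar sf; rewrite (symmetry_boundary fb).
  by case: e => /=; rewrite ?expr1 ?mulN1r ?opprK // mul1r.
rewrite /has_period; apply: iff_sym.
have -> : [set t | start o <= t < stop o /\ boundary s (curve o t)] =
    [set t | start o <= t < start o + (stop o - start o) /\ boundary s (curve o t)].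
  by rewrite subrKC.
have -> : [set t | start o' <= t < stop o' /\ boundary s (curve o' t)] =
    [set t | start o' <= t < start o' + (stop o - start o) /\ boundary s (curve o' t)].
  by rewrite -du subrKC.
suff E : [set t | start o <= t < start o + (stop o - start o) /\ boundary s (curve o t)] #= 
  [set t | start o' <= t < start o' + (stop o - start o) /\ boundary s (curve o' t)].
  by rewrite (card_eql E).
rewrite card_eq_le; apply/andP; split.
  apply: (@card_window _ _ _ e) => // [t ht|m' t ht]; first exact/he.
  by rewrite -du periodic_shiftz.
apply: (@card_window _ _ _ e) => // [t ht|m' t ht].
  by apply/he; rewrite mulrA -expr2 sqrr_sign mul1r.
by rewrite periodic_shiftz.
Qed.

(** A reversal makes departures out of arrivals, but the bounce between them
    preserves both invariants. *)
Lemma normalization_velocity o o' t v : periodic_orbit s o -> normalization s o o' ->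
  departs (curve o') t v -> exists t0 v0, [/\ departs (curve o) t0 v0,
    rate_norm s v = rate_norm s v0 & NC v = NC v0].
Proof.
move=> [tr _ _] [f [e [c [sf ->]]]] /= hv.
have [sg fb] := symmetry_bar sf; have [iso _] := sf.
case: e hv => /= hv.
  have [u [v0 [hu hv0 _]]] := traj_velocities (- t) tr.
  have := symmetry_departs fb (departs_reverse hu) => /(departs_uniq hv) ->.
  have [k [g [_ _ <-]]] := traj_bounce s_gt0 tr hu hv0.
  exists (- t), v0; split=> //.
    rewrite (rate_norm_symlin fb) -(rate_norm_wl s_gt0 k v0) !rate_normE.
    by apply: eq_bigr => i _; rewrite rateN // normrN.
  rewrite -(NC_wl s_gt0 k v0); apply/NC_enorm; rewrite enorm_symlin //.
  by rewrite enormN.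
have [u [v0 [_ hv0 _]]] := traj_velocities t tr.
have := symmetry_departs fb hv0 => /(departs_uniq hv) ->.
exists t, v0; split=> //; first exact: rate_norm_symlin.
by apply/NC_enorm; rewrite enorm_symlin.
Qed.

End Symmetry.

(** * Standard position in coordinates *)

Section Unfoldings.
Variables (R : realType) (s : R).
Hypothesis s_gt0 : 0 < s.
Implicit Types (p q u v z : 'rV[R]_2) (k : weyl) (f g : 'rV[R]_2 -> 'rV[R]_2).
Implicit Types (al : R -> 'rV[R]_2).

Local Notation XC := (coordX s).
Local Notation YC := (coordY s).
Local Notation pt := (at_coords s).
Local Notation NC := (sqnorm s).
Local Notation tr := (lattice_shift s).
Local Notation coordD := (coord_rules s_gt0).
Local Notation cinj := (coord_inj s_gt0).

Local Notation standard := (starts_standard s).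

Lemma NC_half u : NC u = (XC u + YC u / 2) ^+ 2 + 3 / 4 * YC u ^+ 2.
Proof. by rewrite /sqnorm; field. Qed.

Lemma traj_speed al t v : nonsingular_trajectory s al -> departs al t v -> 0 < NC v.
Proof.
move=> [c c0 /(_ t)[_ _ [u [w [[_ hw] [_ nw] _ _]]]]] hv.
have : 0 < s ^+ 2 * NC v.
  by rewrite -(enorm_sq s_gt0) (departs_uniq hv hw) nw exprn_gt0.
by rewrite pmulr_rgt0 // exprn_gt0.
Qed.

(** The squared cosines of 60 and 30 degrees are 1/4 and 3/4. *)
Lemma line_angle_bottom u : 0 < NC u ->
  (pi / 6 <= line_angle u (side_dir s 0) <= pi / 3) =
  (NC u <= 4 * (XC u + YC u / 2) ^+ 2 <= 3 * NC u).
Proof.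
move=> N0; rewrite /line_angle; set x := `|_| / _.
have [v0 v1 v2] := vertexE s; have [[e1 e2 e3] _] := ord3_add.
have sd : side_dir s 0 = pt 1 0.
  by rewrite /side_dir e1 e2 v1 v2; apply: cinj; rewrite !coordD subr0.
have x2 : x ^+ 2 = (XC u + YC u / 2) ^+ 2 / NC u.
  rewrite /x expr_div_n -normrX exprMn !(enorm_sq s_gt0) sd (dotE s_gt0) ger0_norm ?sqr_ge0 //.
  have -> : NC (pt 1 0) = 1 by rewrite /sqnorm !coordD; ring.
  rewrite !coordD; field.
  by rewrite ?(gt_eqF s_gt0) ?(gt_eqF N0).
have x01 : 0 <= x <= 1.
  have xge : 0 <= x by rewrite /x divr_ge0 // mulr_ge0 // /enorm sqrtr_ge0.
  rewrite xge -(@ler_pXn2r _ 2) ?nnegrE // expr1n x2 ler_pdivrMr // mul1r NC_half.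
  by rewrite lerDl; have := sqr_ge0 (YC u); lra.
by rewrite acos_30_60 // x2 ler_pdivlMr // ler_pdivrMr //; congr andb; lra.
Qed.

Lemma in_cone_angle v : 0 < NC v ->
  in_cone s v <-> [/\ NC v <= 4 * (XC v + YC v / 2) ^+ 2 <= 3 * NC v,
     0 < XC v + YC v / 2 & 0 < YC v].
Proof.
move=> N0; rewrite NC_half; split.
  case=> x0 xy y0; split=> //; last by lra.
  by apply/andP; split; nra.
case=> /andP[h1 h2] x0 y0; split=> //; nra.
Qed.

Lemma standard_positionE o : nonsingular_trajectory s (curve o) ->
  standard_position s o <-> exists v, standard (curve o) (start o) v.
Proof.
move=> tr.
have [u [v [hu hv _]]] := traj_velocities (start o) tr.
have N0 := traj_speed tr hv.
have P u' : 0 < NC u' -> u' = mirror (side_dir s 0) v ->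
  (pi / 6 <= line_angle u' (side_dir s 0) <= pi / 3) =
  (NC v <= 4 * (XC v + YC v / 2) ^+ 2 <= 3 * NC v).
  move=> N1 ->; have := rate_mirror s_gt0 0 0 v; have := rate_mirror s_gt0 0 2 v.
  rewrite /side_rate /= => eX eY.
  rewrite line_angle_bottom; last first.
    by move: N0; rewrite /sqnorm eX eY; lra.
  have -> : NC (mirror (side_dir s 0) v) = NC v by rewrite /sqnorm eX eY; ring.
  have -> : XC (mirror (side_dir s 0) v) + YC (mirror (side_dir s 0) v) / 2 = XC v + YC v / 2.
    by rewrite eX eY; field.
  by [].
have pos (w : 'rV[R]_2) : (0 < w 0 0 /\ 0 < w 0 1) <-> (0 < XC w + YC w / 2 /\ 0 < YC w).
  have q0 : 0 < Num.sqrt 3 :> R by rewrite sqrtr_gt0.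
  have c0 : 0 < s * (Num.sqrt 3 / 2) by rewrite mulr_gt0 // divr_gt0.
  by rewrite (entry0 s_gt0) (entry1 s_gt0) (pmulr_rgt0 _ s_gt0) (pmulr_rgt0 _ c0).
split.
  case=> -[th [h0 [u' hu' ->]] hth] [v' hv' /pos [x0 y0]].
  have e := departs_uniq hv' hv; rewrite {}e in x0 y0; exists v; split=> //.
  apply/(in_cone_angle N0); split=> //; rewrite -(P u') //.
    have -> := traj_mirror s_gt0 tr hu' hv h0.
    have := rate_mirror s_gt0 0 0 v; have := rate_mirror s_gt0 0 2 v.
    by rewrite /side_rate /= => eX eY; move: N0; rewrite /sqnorm eX eY; lra.
  exact: (traj_mirror s_gt0 tr hu' hv h0).
case=> w [_ h0 hw cw]; have e := departs_uniq hw hv; rewrite {}e in cw.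
have /(in_cone_angle N0)[h1 h2 h3] := cw; split.
  have em := traj_mirror s_gt0 tr hu hv h0.
  exists (line_angle u (side_dir s 0)); first by split=> //; exists u.
  rewrite P // em.
  have := rate_mirror s_gt0 0 0 v; have := rate_mirror s_gt0 0 2 v.
  by rewrite /side_rate /= => eX eY; move: N0; rewrite /sqnorm eX eY; lra.
by exists v => //; apply/pos.
Qed.

End Unfoldings.

(** * Unfoldings and their displacement vectors *)

Section UnfoldedSegments.
Variables (R : realType) (s : R).
Hypothesis s_gt0 : 0 < s.
Implicit Types (p q u v z : 'rV[R]_2) (f g : 'rV[R]_2 -> 'rV[R]_2).
Implicit Types (al : R -> 'rV[R]_2).

Local Notation wl := (weyl_act s).
Local Notation tr := (lattice_shift s).
Local Notation inW := (unfolding_elt s).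
Local Notation on_lines := (on_tiling s).

Local Notation standard := (starts_standard s).

Lemma increasing_lt (t : nat -> R) m : (forall k, (k < m)%N -> t k < t k.+1) ->
  forall i j, (i < j)%N -> (j <= m)%N -> t i < t j.
Proof.
move=> ht i; elim=> // j IH; rewrite ltnS leq_eqVlt => /predU1P[->|ij] jm.
  exact: ht.
exact: lt_trans (IH ij (ltnW jm)) (ht _ jm).
Qed.

(** The reflections in the edges met agree with the reflections of the
    velocity, because an element of the group is determined by its parity and
    its value at one point that is not a node. *)
Lemma unfolds_vector o v P Q : periodic_orbit s o -> standard (curve o) (start o) v ->
  unfolds_to s o P Q -> P = curve o (start o) /\ Q = P + (stop o - start o) *: v.
Proof.
move=> po [tr side0 hv cv] [m [t [g [_ [t0 tm tlt tP] g0 gS [-> ->]]]]]; split=> //.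
set al := curve o in tr side0 hv tP gS *.
have [_ lt _] := po.
have m0 : (0 < m)%N by case: m tm {tlt tP gS} => // e; move: lt; rewrite -t0 -e ltxx.
have inc := increasing_lt tlt.
have bd k : (k <= m)%N -> boundary s (al (t k)).
  move=> km; apply/tP; last by exists k.
  rewrite -t0 -tm; apply/andP; split.
    by case: k km => // k km; apply/ltW/inc.
  by move: km; rewrite leq_eqVlt => /predU1P[->//|km]; apply/ltW/inc.
have nbd k : (k < m)%N -> forall r, t k < r < t k.+1 -> ~ boundary s (al r).
  move=> km r /andP[r1 r2] /tP[].
    rewrite -t0 -tm; apply/andP; split.
      apply: le_trans (ltW r1); case: k km {r1 r2} => // k km.
      exact/ltW/inc/ltnW.
    apply: le_trans (ltW r2) _; move: km; rewrite leq_eqVlt => /predU1P[->//|km].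
    exact/ltW/inc.
  move=> j jm rj; move: r1 r2; rewrite rj.
  case: (ltngtP j k) => [jk|kj|->]; last by rewrite ltxx.
    by rewrite ltNge ltW // inc // ltnW.
  move=> _; rewrite ltNge; move: kj; rewrite leq_eqVlt => /predU1P[->|kj]; first by rewrite lexx.
  by rewrite ltW // inc.
have main k : (k < m)%N -> exists w, [/\ inW w (g k), odd_weyl w = odd k,
    g k (al (t k)) = al (start o) + (t k - start o) *: v &
    forall v', departs al (t k) v' -> wl w v' = v].
  elim: k => [|k IH] km.
    exists WId; rewrite g0 t0; split=> //; first exact: inW_id.
      by rewrite subrr scale0r addr0.
    by move=> v' hv'; rewrite wl1 // (departs_uniq hv' hv).
  have [w [hw ow gk lw]] := IH (ltnW km).
  have [_ [vk [_ hvk _]]] := traj_velocities (t k) tr.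
  have [e1 hu] := straight_line tr hvk (tlt _ (ltnW km)) (nbd _ (ltnW km)).
  have [p [q [te sg gE]]] := gS k km.
  have [w1 [ow1 hw1 fix1]] := tile_edge_reflection s_gt0 te.
  have [w2 [ow2 _ hw2]] := inW_comp s_gt0 hw1 hw; rewrite -gE in hw2.
  have line : g k (al (t k.+1)) = al (start o) + (t k.+1 - start o) *: v.
    rewrite e1 (inW_add s_gt0 _ _ hw) wlZ // (lw _ hvk) gk -addrA -scalerDl.
    by congr (_ + _ *: _); ring.
  exists w2; split=> //; first by rewrite ow2 ow1 ow.
    by rewrite gE /= fix1.
  move=> v' hv'; have [i hi] := bd _ (ltnW km).
  have [w3 [g3 [ow3 hw3 fix3 lw3]]] := side_reflection s_gt0 i.
  have [w4 [ow4 lw4 hw4]] := inW_comp s_gt0 hw hw3.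
  have /(sideP s_gt0)[_ b0] := hi.
  have [|||_ ->] := inW_eq s_gt0 (p := al (t k.+1)) hw2 hw4.
  - by rewrite ow2 ow1 ow4 ow3 ow addbC.
  - by rewrite gE /= fix1 //= fix3.
  - exact: traj_nonode.
  by rewrite lw4 lw3 -(traj_mirror s_gt0 tr hu hv' hi) (lw _ hvk).
have m1 : (m.-1 < m)%N by rewrite prednK.
have [w [hw _ gk lw]] := main _ m1.
have [_ [vk [_ hvk _]]] := traj_velocities (t m.-1) tr.
have tmE : t m.-1.+1 = stop o by rewrite prednK.
have [e1 _] := straight_line tr hvk (tlt _ m1) (nbd _ m1).
have -> : al (start o) = al (stop o).
  by have [_ _ /(_ 0)] := po; rewrite !addr0.
rewrite -{1}tmE e1 (inW_add s_gt0 _ _ hw) wlZ // (lw _ hvk) gk -addrA -scalerDl.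
have -> : al (start o) = al (stop o).
  by have [_ _ /(_ 0)] := po; rewrite !addr0.
by congr (_ + _ *: _); rewrite tmE; ring.
Qed.

(** The strike times are the sorted crossing times. At each strike any tile
    edge through the point reached will do, as that point lies on one line of
    the tiling only. *)
Lemma unfolds_exists o v : periodic_orbit s o -> standard (curve o) (start o) v ->
  exists P Q, unfolds_to s o P Q.
Proof.
move=> po st; have [tr side0 hv cv] := st.
have [_ lt pe] := po; set al := curve o in tr side0 hv *.
have T0 : 0 < stop o - start o by rewrite subr_gt0.
have [q [uq qP _]] := standard_strikes s_gt0 st T0 (fun t => periodic_shift t po).
rewrite subrKC -/al in qP.
pose q' := sort <=%R q; pose m := size q; pose t k := nth (stop o) q' k.
have q'P r : r \in q' <-> start o <= r < stop o /\ boundary s (al r) by rewrite mem_sort.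
have sq' : size q' = m by rewrite size_sort.
have sorted_q' : sorted <%R q' by rewrite sort_lt_sorted.
have tin k : (k < m)%N -> t k \in q' by move=> km; rewrite mem_nth // sq'.
have tm : t m = stop o by rewrite /t nth_default // sq'.
have tlt k : (k < m)%N -> t k < t k.+1.
  move=> km; move: (km); rewrite leq_eqVlt => /predU1P[->|km1].
    by rewrite tm; have /q'P[/andP[]] := tin _ km.
  by rewrite /t (lt_sorted_ltn_nth _ sorted_q') ?inE ?sq'.
have startb : boundary s (al (start o)) by exists 0.
have stopb : boundary s (al (stop o)).
  by rewrite /al -[stop o]addr0 -pe addr0.
have startq : start o \in q' by apply/q'P; rewrite lexx lt.
have m0 : (0 < m)%N by rewrite -sq'; case: q' startq {q'P sq' sorted_q' t tin tm tlt}.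
have t0 : t 0%N = start o.
  apply/eqP; rewrite eq_le; have /q'P[/andP[-> _] _] := tin _ m0; rewrite andbT.
  rewrite -(nth_index (stop o) startq) /t (lt_sorted_leq_nth _ sorted_q') ?inE ?sq' //.
  by rewrite -sq' index_mem.
have tP r : start o <= r <= stop o ->
    boundary s (al r) <-> exists2 k, (k <= m)%N & r = t k.
  move=> /andP[r1 r2]; split=> [b|[k km ->]].
    move: r2; rewrite le_eqVlt => /predU1P[->|r2]; first by exists m.
    have rq : r \in q' by apply/q'P; rewrite r1.
    exists (index r q'); last by rewrite /t nth_index.
    by rewrite -sq' index_size.
  move: km; rewrite leq_eqVlt => /predU1P[->|km]; first by rewrite tm.
  by have /q'P[] := tin _ km.
have [E hE] : exists E : 'rV[R]_2 -> 'rV[R]_2 * 'rV[R]_2, forall z, on_lines z ->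
    tile_edge s (E z).1 (E z).2 /\ segment (E z).1 (E z).2 z.
  have ch z : exists e : 'rV[R]_2 * 'rV[R]_2, on_lines z ->
      tile_edge s e.1 e.2 /\ segment e.1 e.2 z.
    have [/(on_lines_edge s_gt0)[a [b h]]|n] := pselect (on_lines z); first by exists (a, b).
    by exists (0, 0).
  by have [E hE] := choice ch; exists E.
pose g := fix g k : 'rV[R]_2 -> 'rV[R]_2 := if k is k'.+1 then
   let e := E (g k' (al (t k'.+1))) in reflect_line e.1 e.2 \o g k' else id.
have ol k w : (k <= m)%N -> inW w (g k.-1) -> on_lines (g k.-1 (al (t k))).
  move=> km hw; apply/(on_lines_inW s_gt0 _ hw)/(boundaryE s_gt0); first exact: traj_table.
  move: km; rewrite leq_eqVlt => /predU1P[->|km]; first by rewrite tm.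
  by have /q'P[] := tin _ km.
have hg k : (k < m)%N -> exists w, inW w (g k).
  elim: k => [|k IH] km; first by exists WId; exact: inW_id.
  have [w hw] := IH (ltnW km); have [te _] := hE _ (ol k.+1 _ (ltnW km) hw).
  have [w1 [_ hw1 _]] := tile_edge_reflection s_gt0 te.
  by have [w2 [_ _ hw2]] := inW_comp s_gt0 hw1 hw; exists w2.
exists (al (start o)), (g m.-1 (al (start o))), m, t, g; split=> //.
  apply: (@seq_card_eq _ _ q') => //; first by rewrite sort_uniq.
move=> k km; have [w hw] := hg _ (ltnW km).
have [te sg] := hE _ (ol k.+1 _ (ltnW km) hw).
by eexists _, _; split; [exact: te|exact: sg|].
Qed.

End UnfoldedSegments.

(** * Every periodic orbit can be normalized *)

Section Normalization.
Variables (R : realType) (s : R).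
Hypothesis s_gt0 : 0 < s.
Implicit Types (p q u v z : 'rV[R]_2) (f g : 'rV[R]_2 -> 'rV[R]_2).
Implicit Types (al : R -> 'rV[R]_2).

Local Notation XC := (coordX s).
Local Notation YC := (coordY s).
Local Notation rate := (side_rate s).
Local Notation bar := (barycentric s).
Local Notation NC := (sqnorm s).
Local Notation wl := (weyl_act s).
Local Notation tr := (lattice_shift s).
Local Notation inW := (unfolding_elt s).
Local Notation coordD := (coord_rules s_gt0).

Local Notation standard := (starts_standard s).

Definition permute_bar (sg : 'S_3) p := \sum_i bar i p *: vertex s (sg i).

Lemma permute_barE (sg : 'S_3) i p : bar (sg i) (permute_bar sg p) = bar i p.
Proof.
rewrite /permute_bar sum3 !barE // !rateD // !rateZ //.
have rv l : rate (sg i) (vertex s (sg l)) = (i == l)%:R - (sg i == 1)%:R.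
  by have := bar_vertex s_gt0 (sg i) (sg l); rewrite barE // (inj_eq perm_inj); lra.
rewrite !rv; have := bar_sum s p.
by elim/ord3_ind: i {rv} => /= b1; rewrite /barycentric /side_rate /= in b1 *; ring.
Qed.

Lemma NC_rate u : NC u = (\sum_i rate i u ^+ 2) / 2.
Proof. by rewrite sum3 /sqnorm /side_rate /=; field. Qed.

Lemma permute_bar_symmetry (sg : 'S_3) : triangle_symmetry s (permute_bar sg).
Proof.
split.
  move=> p q; apply/(NC_enorm s_gt0); rewrite !NC_rate; congr (_ / _).
  rewrite (reindex_inj (@perm_inj _ sg)) /=; apply: eq_bigr => i _; congr (_ ^+ 2).
  have := permute_barE sg i p; have := permute_barE sg i q.
  by rewrite !barE // !rateD // !rateN //; lra.
exists sg => i; apply: (bar_inj s_gt0); apply: (@perm_surj sg) => j.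
by rewrite permute_barE !bar_vertex // (inj_eq perm_inj).
Qed.

(** Non-negative when the rate of family i is the median one in absolute
    value, that is, when the angle with the lines of that family is between 30
    and 60 degrees. *)
Definition median (i : 'I_3) u : R :=
  (rate i u ^+ 2 - rate (i + 1) u ^+ 2) * (rate (i + 2) u ^+ 2 - rate i u ^+ 2).

(** The product of the three values is a square. *)
Lemma median_ex u : exists i, 0 <= median i u.
Proof.
have [[e1 e2 e3] [e4 e5 e6]] := ord3_add.
apply: contrapT => h.
have n i : median i u < 0 by rewrite ltNge; apply/negP => hi; apply: h; exists i.
have := n 0; have := n 1; have := n 2; rewrite /median e1 e2 e3 e4 e5 e6.
set a := rate 0 u ^+ 2; set b := rate 1 u ^+ 2; set c := rate 2 u ^+ 2.
move=> h2 h1 h0; have := nmulr_rgt0 _ h2; move=> /(_ ((b - c) * (a - b))) .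
rewrite h1 => h12.
have : 0 <= ((a - b) * (c - a) * (b - c)) ^+ 2 by apply: sqr_ge0.
have -> : ((a - b) * (c - a) * (b - c)) ^+ 2 =
  ((a - b) * (c - a)) * (((c - a) * (b - c)) * ((b - c) * (a - b))) by ring.
by rewrite leNgt nmulr_rlt0 // h12.
Qed.

Lemma wl_median k i : exists j, (forall u, rate i (wl k u) =
  (if odd_weyl k then -1 else 1) * rate j u) /\ forall u, median i (wl k u) = median j u.
Proof.
have [[e1 e2 e3] [e4 e5 e6]] := ord3_add.
rewrite /median; elim/ord3_ind: i; rewrite ?e1 ?e2 ?e3 ?e4 ?e5 ?e6; case: k;
  first [exists 0; rewrite ?e1 ?e2; by split=> u; rewrite /side_rate /= !coordD /=; ring
        |exists 1; rewrite ?e3 ?e4; by split=> u; rewrite /side_rate /= !coordD /=; ring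
        |exists 2; rewrite ?e5 ?e6; by split=> u; rewrite /side_rate /= !coordD /=; ring].
Qed.

Lemma inW_median k g i : inW k g -> exists j,
  (forall p, isint (rate i (g p)) <-> isint (rate j p)) /\
  forall u, median i (wl k u) = median j u.
Proof.
case=> b [c hg]; have [j [hj hm]] := wl_median k i; exists j; split=> // p.
by rewrite hg rateD // hj; apply: isint_signD; apply: isint_tr.
Qed.

Lemma median_neq0 i u : 0 < NC u -> 0 <= median i u -> rate i u != 0.
Proof.
have [[e1 e2 e3] [e4 e5 e6]] := ord3_add.
move=> N0; rewrite /median => h; apply/eqP => e.
have : NC u <= 0; last by lra.
move: N0 h e; rewrite NC_rate sum3; have := rate_sum s u.
elim/ord3_ind: i; rewrite ?e1 ?e2 ?e3 ?e4 ?e5 ?e6;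
move: (rate 0 u) (rate 1 u) (rate 2 u) => a b c sm N0 h e; rewrite e in sm h N0 *.
- have ec : c = - b by lra.
  by rewrite ec in h N0 *; nra.
- have ec : c = - a by lra.
  by rewrite ec in h N0 *; nra.
- have ec : b = - a by lra.
  by rewrite ec in h N0 *; nra.
Qed.

Lemma line_hits_int (c r : R) : r != 0 -> exists2 x, 0 <= x & isint (c + x * r).
Proof.
have fl (y : R) : exists m : int, m%:~R <= y /\ y < m%:~R + 1.
  by exists (Num.floor y); have /andP[] := Num.Theory.floor_itv y; rewrite intrD.
have [m [m1 m2]] := fl c.
case: (ltrgtP r 0) => // r0 _.
  exists ((m%:~R - c) / r); last by exists m; rewrite divfK ?lt_eqF // subrKC.
  by rewrite nmulr_lge0 ?invr_lt0 ?subr_le0.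
exists (((m + 1)%:~R - c) / r); last by exists (m + 1); rewrite divfK ?gt_eqF // subrKC.
by rewrite divr_ge0 ?(ltW r0) // subr_ge0 intrD ltW.
Qed.

Lemma median_between (a b c : R) : a + b + c = 0 -> 0 < a ->
  0 <= (a ^+ 2 - b ^+ 2) * (c ^+ 2 - a ^+ 2) -> 0 <= b <= a \/ 0 <= c <= a.
Proof.
(* substituting c makes the product factor into linear terms of known sign *)
move=> sm a0; have -> : c = - a - b by lra.
have -> : (a ^+ 2 - b ^+ 2) * ((- a - b) ^+ 2 - a ^+ 2) =
  (a - b) * (a + b) * b * (2 * a + b) by ring.
move=> h; have [b0|b0] := leP 0 b.
  left; rewrite leNgt; apply/negP => ab.
  have : 0 < (b - a) * (a + b) * b * (2 * a + b) by rewrite !mulr_gt0 //; lra.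
  lra.
right; apply/andP; split; rewrite leNgt; apply/negP => hc.
  have : 0 < (a - b) * (a + b) * (- b) * (2 * a + b) by rewrite !mulr_gt0 //; lra.
  lra.
have : 0 < (a - b) * (- (a + b)) * (- b) * (- (2 * a + b)) by rewrite !mulr_gt0 //; lra.
lra.
Qed.

Lemma perm_two (j l : 'I_3) : j != l -> exists sg : 'S_3, sg j = 0 /\ sg l = 2.
Proof.
move=> jl; exists (tperm j 0 * tperm (tperm j 0 l) 2)%g.
have h : tperm j 0 l != 0.
  by rewrite -[X in _ != X](tpermL j 0) (inj_eq perm_inj) eq_sym.
by rewrite !permM !tpermL (tpermD h).
Qed.

(** The unfolded line reaches the family of lines of median rate. The
    reflections permute the families, so at that time the orbit strikes a side
    at an angle between 30 and 60 degrees, and a symmetry of the triangle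
    moves this strike to standard position. *)
Lemma normalizable o : periodic_orbit s o -> exists o' v,
  normalization s o o' /\ standard (curve o') (start o') v.
Proof.
move=> po; have [tr lt pe] := po; have [[e1 e2 e3] [e4 e5 e6]] := ord3_add.
have [_ [v [_ hv _]]] := traj_velocities (start o) tr.
have N0 := traj_speed s_gt0 tr hv.
have [i mi] := median_ex v.
have [x x0 hx] := line_hits_int (rate i (curve o (start o))) (median_neq0 N0 mi).
pose t := start o + x; have tle : start o <= t by rewrite lerDl.
have [k [g [hg gt lg]]] := unfolding_line s_gt0 tr hv tle.
have [_ [u [_ hu _]]] := traj_velocities t tr.
have [j [jint jmed]] := inW_median i hg.
have mj : 0 <= median j u by rewrite -jmed (lg _ hu).
have Nu := traj_speed s_gt0 tr hu.
have tb := traj_table t tr; have nn := traj_nonode s_gt0 (t := t) tr.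
have ji : isint (rate j (curve o t)).
  by apply/jint; rewrite gt rateD // rateZ // (_ : t - start o = x) // /t; ring.
have bj : bar j (curve o t) = 0.
  have /(tableE s_gt0)[tx ty txy] := tb.
  have [m hm] := isintD ji (isint_int R (j == 1)%:Z); rewrite -barE // in hm.
  have /(tableP s_gt0)/(_ j) b0 := tb.
  have b1 : bar j (curve o t) < 1.
    rewrite ltNge; apply/negP => b1; apply: nn.
    rewrite /is_node; move: j b1 {mj jint jmed ji hm b0} => j.
    elim/ord3_ind: j; rewrite /barycentric /= => b1.
    - by split; [exists 0; lra|exists 1; lra].
    - by split; exists 0; lra.
    - by split; [exists 1; lra|exists 0; lra].
  by apply: isint_small; [exists m|lra|].
have r0 : 0 < rate j u.
  rewrite lt_neqAle eq_sym (median_neq0 Nu mj) /=.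
  have [e e0 he] := hu; pose h := e / 2.
  have /(tableP s_gt0)/(_ j) := traj_table (t + h) tr.
  rewrite he; last by apply/andP; rewrite /h; split; lra.
  by rewrite barD // bj add0r rateZ // pmulr_rge0 // /h; lra.
have [l [jl l0 l1]] : exists l, [/\ j != l, 0 <= rate l u & rate l u <= rate j u].
  have sm : rate j u + rate (j + 1) u + rate (j + 2) u = 0.
    by have := rate_sum s u; move: (j) => j'; elim/ord3_ind: j';
      rewrite ?e1 ?e2 ?e3 ?e4 ?e5 ?e6; lra.
  have [jn1 jn2] : j != j + 1 /\ j != j + 2.
    by move: (j) => j'; elim/ord3_ind: j'; rewrite ?e1 ?e2 ?e3 ?e4 ?e5 ?e6.
  case: (median_between sm r0 mj) => /andP[h1 h2]; [by exists (j + 1)|by exists (j + 2)].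
have [sg [sgj sgl]] := perm_two jl.
pose f := permute_bar sg; have sf := permute_bar_symmetry sg; have [iso _] := sf.
have fb := permute_barE sg.
exists (change_initial x (relabel f o)), (symlin f u); split.
  by exists f, false, x.
split=> /=.
- exact: (symmetry_trajectory s_gt0 iso fb).
- rewrite -sgj; apply/(symmetry_side s_gt0 fb)/(sideP s_gt0); split=> //.
- exact: (symmetry_departs s_gt0 fb).
have rX : XC (symlin f u) = rate l u by rewrite -(symlin_rate fb) sgl.
have rY : YC (symlin f u) = rate j u by rewrite -(symlin_rate fb) sgj.
by rewrite /in_cone rX rY.
Qed.

End Normalization.

(** * Classes as displacement vectors *)

Section Classes.
Variables (R : realType) (s : R).
Hypothesis s_gt0 : 0 < s.
Implicit Types (p q u v z V : 'rV[R]_2) (f g : 'rV[R]_2 -> 'rV[R]_2).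
Implicit Types (al : R -> 'rV[R]_2) (o : timed_curve R).

Local Notation XC := (coordX s).
Local Notation YC := (coordY s).
Local Notation pt := (at_coords s).
Local Notation tr := (lattice_shift s).
Local Notation coordD := (coord_rules s_gt0).
Local Notation cinj := (coord_inj s_gt0).

Local Notation standard := (starts_standard s).

(** The unfolding of the normalized orbit has displacement stop - start times
    this vector. *)
Definition standard_velocity o v :=
  exists o', normalization s o o' /\ standard (curve o') (start o') v.

(** The equivalence classes turn out to be exactly these sets: all unfoldings
    start on the line BC, so that only the displacement matters. *)
Definition vector_class V : set (timed_curve R) :=
  [set o | periodic_orbit s o /\ exists2 v, standard_velocity o v & V = (stop o - start o) *: v].

Lemma standard_velocity_ex o : periodic_orbit s o -> exists v, standard_velocity o v.
Proof. by move=> /(normalizable s_gt0)[ o' [v h]]; exists v, o'. Qed.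

(** It depends on the curve only: it is the representative in the cone of a
    velocity whose invariants are conserved. *)
Lemma standard_velocity_uniq o o2 v v2 : periodic_orbit s o -> periodic_orbit s o2 ->
  curve o = curve o2 -> standard_velocity o v -> standard_velocity o2 v2 -> v = v2.
Proof.
move=> po po2 cu [ o' [no [_ _ hv cv]]] [ o2' [no2 [_ _ hv2 cv2]]].
have [t [w [hw ew Nw]]] := normalization_velocity s_gt0 po no hv.
have [t2 [w2 [hw2 ew2 Nw2]]] := normalization_velocity s_gt0 po2 no2 hv2.
rewrite -cu in hw2; have [tr _ _] := po.
have [e1 e2] := traj_conserved s_gt0 tr hw hw2.
by apply: (in_cone_inj s_gt0 cv cv2); [rewrite ew ew2|rewrite Nw Nw2].
Qed.

Lemma standard_velocity_refl o v : standard (curve o) (start o) v -> standard_velocity o v.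
Proof.
move=> st; exists o; split=> //; exists id, false, 0; split.
  by split=> //; exists 1%g => i; rewrite perm1.
by rewrite /change_initial /relabel /= !addr0; case: o {st}.
Qed.

Lemma unfolding_displacement o P Q : periodic_orbit s o -> unfolding s o P Q ->
  YC P = 0 /\ exists2 v, standard_velocity o v & Q = P + (stop o - start o) *: v.
Proof.
move=> po [ o' [no sp uf]].
have po' := normalization_periodic s_gt0 po no; have [tr' _ _] := po'.
have [v st] := (standard_positionE s_gt0 tr').1 sp.
have [eP eQ] := unfolds_vector s_gt0 po' st uf.
have [y0 _] := standard_start s_gt0 st.
by rewrite {1}eP y0; split=> //; exists v; [exists o'|rewrite -(normalization_duration no)].
Qed.

Lemma unfolding_ex o v : periodic_orbit s o -> standard_velocity o v ->
  exists P Q, unfolding s o P Q.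
Proof.
move=> po [ o' [no st]]; have po' := normalization_periodic s_gt0 po no.
have [tr' _ _] := po'; have [P [Q h]] := unfolds_exists s_gt0 po' st.
by exists P, Q, o'; split=> //; apply/(standard_positionE s_gt0 tr'); exists v.
Qed.

(** Two unfoldings start on the line BC, hence they differ by a horizontal
    translation as soon as their displacements agree. *)
Lemma equivalentE o o2 : periodic_orbit s o -> periodic_orbit s o2 ->
  equivalent s o o2 <-> exists V, vector_class V o /\ vector_class V o2.
Proof.
move=> po po2; split.
  case=> P [Q [P' [Q' [/(unfolding_displacement po)[_ [v dv eQ]]
    /(unfolding_displacement po2)[_ [v2 dv2 eQ']] [h [eP' eQ2]]]]]].
  exists ((stop o - start o) *: v); split; split=> //; first by exists v.
  exists v2 => //; apply: (addrI P'); rewrite -eQ' eQ2 eQ eP'.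
  by rewrite addrAC.
case=> V [[_ [v dv eV]] [_ [v2 dv2 eV2]]].
have [P [Q uf]] := unfolding_ex po dv.
have [P' [Q' uf']] := unfolding_ex po2 dv2.
have [y0 [w dw eQ]] := unfolding_displacement po uf.
have [y0' [w2 dw2 eQ']] := unfolding_displacement po2 uf'.
rewrite -(standard_velocity_uniq po po erefl dv dw) -eV in eQ.
rewrite -(standard_velocity_uniq po2 po2 erefl dv2 dw2) -eV2 in eQ'.
exists P, Q, P', Q'; split=> //; exists (P' 0 0 - P 0 0).
have eP : P' = P + vec (P' 0 0 - P 0 0) 0.
  apply/rowP => j; case: (unliftP ord0 j) => [i|] ->.
    rewrite ord1 (_ : lift _ _ = 1); last exact: val_inj.
    by rewrite [in RHS]mxE vec_1 addr0 !(entry1 s_gt0) y0 y0'.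
  by rewrite [in RHS]mxE vec_0 subrKC.
by split=> //; rewrite eQ eQ' {1}eP addrAC.
Qed.

Lemma class_ofE o V : vector_class V o -> class_of s o = vector_class V.
Proof.
move=> oV; have [po [v dv eV]] := oV; apply/seteqP; split=> o2.
  case=> po2 /(equivalentE po po2)[V2 [[_ [w dw eV2]] h]].
  by rewrite eV (standard_velocity_uniq po po erefl dv dw) -eV2.
by move=> h; have [po2 _] := h; split=> //; apply/(equivalentE po po2); exists V.
Qed.

Lemma vector_class_uniq o V V' : vector_class V o -> vector_class V' o -> V = V'.
Proof.
move=> [po [v dv ->]] [_ [v' dv' ->]].
by rewrite (standard_velocity_uniq po po erefl dv dv').
Qed.

Lemma vector_class_ex o : periodic_orbit s o -> exists V, vector_class V o.
Proof.
move=> po; have [v dv] := standard_velocity_ex po.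
by exists ((stop o - start o) *: v); split=> //; exists v.
Qed.

Lemma vector_class_period V o : vector_class V o ->
  (exists m n, even_vector s V m n /\ has_period s o (2 * (2 * m + 3 * n)))%N \/
  (exists j, odd_vector s V j /\ has_period s o (6 * j + 3))%N.
Proof.
case=> po [v [ o' [no st]] eV].
have po' := normalization_periodic s_gt0 po no.
have [_ lt' _] := po'; have T0 : 0 < stop o' - start o' by rewrite subr_gt0.
have [q [uq qP]] := standard_strikes s_gt0 st T0 (fun t => periodic_shift t po').
rewrite subrKC in qP; rewrite (normalization_duration no) -eV.
have hp n : size q = n -> has_period s o n.
  by move=> sq; apply/(normalization_period s_gt0 n po no)/(seq_card_eq uq sq).
case=> [[m [n [h1 h2]]]|[j [h1 h2]]]; [left|right].
  by exists m, n; split=> //; apply: hp.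
by exists j; split=> //; apply: hp.
Qed.

Lemma has_period_uniq o m n : has_period s o m -> has_period s o n -> m = n.
Proof.
by move=> hm hn; apply/card_eq_II; apply: card_eq_trans hn; rewrite card_eq_sym.
Qed.

Lemma even_vector_inj V m n m' n' : even_vector s V m n -> even_vector s V m' n' ->
  m = m' /\ n = n'.
Proof.
rewrite /even_vector => -> e.
have := congr1 XC e; have := congr1 YC e; rewrite !coordD.
by move=> /eqP + /eqP; rewrite !eqr_nat => /eqP h1 /eqP h2; split; lia.
Qed.

Lemma even_not_odd V m n j : even_vector s V m n -> odd_vector s V j -> False.
Proof.
rewrite /even_vector => -> e.
have := congr1 XC e; have := congr1 YC e; rewrite !coordD => h _.
have : (2 * (m + 3 * n))%:R = (3 + 6 * j)%:R :> R by rewrite !(natrM, natrD) in h *; lra.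
by move/eqP; rewrite eqr_nat; clear; lia.
Qed.

(** The translations of the lattice that lie in the cone. The pair (m, n) is
    linear in the vector, so that divisibility in the lattice is divisibility
    of the pair. *)
Definition lattice_vector m n := pt m%:R (m + 3 * n)%:R.

Lemma vector_class_even m n o : vector_class (lattice_vector m n) o ->
  has_period s o (2 * (2 * m + 3 * n))%N.
Proof.
move=> h; case: (vector_class_period h) => [[m' [n' [e hp]]]|[j [e _]]].
  by have [<- <-] := even_vector_inj e (erefl : even_vector s _ m n).
by have := @even_not_odd (lattice_vector m n) m n j erefl e.
Qed.

Lemma iterate_periodic o n : (0 < n)%N -> periodic_orbit s o -> periodic_orbit s (iterate o n).
Proof.
move=> n0 po; have [tr lt _] := po; split=> //=.
  by rewrite ltrDl mulr_gt0 ?ltr0n // subr_gt0.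
move=> t; rewrite addrAC; have := periodic_shiftz n (start o + t) po.
by rewrite -pmulrn => ->.
Qed.

Lemma iterate_vector o V n : (0 < n)%N -> vector_class V o ->
  vector_class (n%:R *: V) (iterate o n).
Proof.
move=> n0 [po [v dv ->]]; have po2 := iterate_periodic n0 po; split=> //.
have [w dw] := standard_velocity_ex po2.
rewrite (standard_velocity_uniq po po2 erefl dv dw); exists w => //=.
by rewrite scalerA addrAC subrr add0r.
Qed.

(** Period 3 leaves only the shortest glide reflection, whose square is the
    translation by three sides. *)
Lemma fagnano_vector o : fagnano s o -> vector_class (lattice_vector 0 1) (iterate o 2).
Proof.
case=> po _ p3 _; have [V oV] := vector_class_ex po.
case: (vector_class_period oV) => [[m [n [_ hp]]]|[j [e hp]]].
  by have := has_period_uniq p3 hp; lia.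
have j0 : j = 0%N by have := has_period_uniq p3 hp; lia.
have -> : lattice_vector 0 1 = 2%:R *: V.
  by rewrite e j0; apply: cinj; rewrite !coordD ?mulr0 //; field.
exact: iterate_vector.
Qed.

(** A shorter period T' of the curve is the duration of another orbit with the
    same velocity, so T' v is a holonomy vector as well. It is not odd because
    m is positive, and a lattice vector parallel to (m, n) has length at least
    that of (m, n) when m and n are coprime. *)
Lemma coprime_primitive m n o : (0 < m)%N -> coprime m n ->
  vector_class (lattice_vector m n) o -> primitive_orbit o.
Proof.
move=> m0 mn [po [v dv eV]]; have [tr lt _] := po.
have T0 : 0 < stop o - start o by rewrite subr_gt0.
split=> //; exists (stop o - start o); last by rewrite mul1r.
split=> // [t|T' T'0 hT']; first exact: (periodic_shift t po).
pose o2 := TimedCurve (curve o) (start o) (start o + T').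
have po2 : periodic_orbit s o2.
  by split=> //= [|t]; [rewrite ltrDl|rewrite addrAC hT'].
have o2V : vector_class (T' *: v) o2.
  split=> //; have [w dw] := standard_velocity_ex po2.
  rewrite (standard_velocity_uniq po po2 erefl dv dw); exists w => //=.
  by rewrite addrAC subrr add0r.
have eX : m%:R = (stop o - start o) * XC v by rewrite -(XCZ s) -eV !coordD.
have eY : (m + 3 * n)%:R = (stop o - start o) * YC v by rewrite -(YCZ s) -eV !coordD.
have vX : 0 < XC v by rewrite -(pmulr_rgt0 _ T0) -eX ltr0n.
case: (vector_class_period o2V) => [[m' [n' [e _]]]|[j [e _]]].
  have eX' : m'%:R = T' * XC v by rewrite -(XCZ s) e !coordD.
  have eY' : (m' + 3 * n')%:R = T' * YC v by rewrite -(YCZ s) e !coordD.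
  have cross : (m * n' = m' * n)%N.
    have : (m * (m' + 3 * n'))%:R = (m' * (m + 3 * n))%:R :> R.
      by rewrite !natrM eX eY' eX' eY; ring.
    by move/eqP; rewrite eqr_nat; lia.
  have m'0 : (0 < m')%N by rewrite -(ltr0n R) eX' mulr_gt0.
  have : (m %| m')%N by rewrite -(Gauss_dvdl _ mn) -cross dvdn_mulr.
  by move=> /(dvdn_leq m'0); rewrite -(ler_nat R) eX eX' ler_pM2r.
have : 0 < XC (T' *: v) by rewrite XCZ mulr_gt0.
by rewrite e XC_pt // ltxx.
Qed.

End Classes.

(** * Folding a line into a trajectory *)

Section Folding.
Variables (R : realType) (s : R).
Hypothesis s_gt0 : 0 < s.
Implicit Types (p q u v w z V : 'rV[R]_2) (f g : 'rV[R]_2 -> 'rV[R]_2).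
Implicit Types (al : R -> 'rV[R]_2) (o : timed_curve R).

Local Notation XC := (coordX s).
Local Notation YC := (coordY s).
Local Notation pt := (at_coords s).
Local Notation rate := (side_rate s).
Local Notation bar := (barycentric s).
Local Notation NC := (sqnorm s).
Local Notation wl := (weyl_act s).
Local Notation tr := (lattice_shift s).
Local Notation inW := (unfolding_elt s).
Local Notation isnode := (is_node s).
Local Notation coordD := (coord_rules s_gt0).
Local Notation cinj := (coord_inj s_gt0).

Local Notation standard := (starts_standard s).

(** The folded point does not depend on the group element, the triangle being
    a fundamental domain. *)
Lemma fold_ex : exists F : 'rV[R]_2 -> 'rV[R]_2,
  (forall p, table s (F p)) /\
  forall k g p, inW k g -> table s (g p) -> F p = g p.
Proof.
have ch p : exists q, table s q /\ exists k g, inW k g /\ q = g p.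
  by have [k [g [hg tg]]] := inW_cover s_gt0 p; exists (g p); split=> //; exists k, g.
have [F hF] := choice ch; exists F; split=> [p|k g p hg tg]; first by have [] := hF p.
have [tF [k1 [g1 [hg1 e1]]]] := hF p.
have [k2 [g2 [_ _ hg2 gK]]] := inW_inv s_gt0 hg1.
have [k3 [_ _ hg3]] := inW_comp s_gt0 hg hg2.
have e : (g \o g2) (F p) = g p by rewrite /= e1 gK.
by rewrite -e; apply/esym/(inW_table s_gt0 hg3) => //; rewrite e.
Qed.

Definition fold_plane : 'rV[R]_2 -> 'rV[R]_2 := projT1 (cid fold_ex).
Let F := fold_plane.

Lemma fold_table p : table s (F p).
Proof. by rewrite /F /fold_plane; case: (cid fold_ex) => G []. Qed.

Lemma foldE k g p : inW k g -> table s (g p) -> F p = g p.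
Proof. by rewrite /F /fold_plane; case: (cid fold_ex) => G [_ h] /=; apply: h. Qed.

Lemma fold_inW p : exists k g, inW k g /\ F p = g p.
Proof.
have [k [g [hg tg]]] := inW_cover s_gt0 p.
by exists k, g; split=> //; apply: foldE hg tg.
Qed.

Lemma fold_invariant k g p : inW k g -> F (g p) = F p.
Proof.
move=> hg; have [k1 [g1 [hg1 e1]]] := fold_inW (g p).
have [k2 [_ _ hg2]] := inW_comp s_gt0 hg1 hg.
by rewrite e1 (foldE (p := p) hg2) //= -e1; apply: fold_table.
Qed.

(** Barycentric coordinates vary linearly, hence only those that vanish at q
    can become negative at once. *)
Lemma table_move q w : table s q -> (forall j, bar j q = 0 -> 0 <= rate j w) ->
  exists2 e, 0 < e & forall h, 0 <= h < e -> table s (q + h *: w).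
Proof.
move=> /(tableP s_gt0) tq hw.
have ej j : exists2 e, 0 < e & forall h, 0 <= h < e -> 0 <= bar j (q + h *: w).
  have [r0|r0] := leP 0 (rate j w).
    exists 1 => // h /andP[h0 _]; rewrite barD // rateZ //.
    by rewrite addr_ge0 // mulr_ge0.
  have b0 : 0 < bar j q.
    rewrite lt_neqAle tq andbT; apply/eqP => e.
    by have := hw j (esym e); lra.
  exists (bar j q / - rate j w); first by rewrite divr_gt0 // oppr_gt0.
  move=> h /andP[_]; rewrite ltr_pdivlMr ?oppr_gt0 // barD // rateZ //; lra.
have [e0 p0 h0] := ej 0; have [e1 p1 h1] := ej 1; have [e2 p2 h2] := ej 2.
exists (Num.min e0 (Num.min e1 e2)); first by rewrite !lt_min p0 p1 p2.
move=> h /andP[hge]; rewrite !lt_min => /and3P[l0 l1 l2]; apply/(tableP s_gt0) => j.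
by elim/ord3_ind: j; [apply: h0|apply: h1|apply: h2]; rewrite hge.
Qed.

(** At a strike the curve follows one image of the line before and its mirror
    image in the side struck after, or conversely, according to the sign of
    the rate at which the first one crosses the side. *)
Lemma fold_trajectory P v : 0 < NC v ->
  (forall t, ~ isnode (P + t *: v)) ->
  (forall t j, isint (rate j (P + t *: v)) -> rate j v != 0) ->
  nonsingular_trajectory s (fun t => F (P + t *: v)).
Proof.
move=> N0 nn tv; set al := fun t => F (P + t *: v).
have v0 : 0 < enorm v.
  rewrite /enorm sqrtr_gt0 (dotE s_gt0) (_ : _ / 2 = XC v * YC v); last by field.
  by move: N0; rewrite /sqnorm => N0; rewrite mulr_gt0 ?exprn_gt0 //; lra.
exists (enorm v) => // t.
have [k [g [hg gE]]] := fold_inW (P + t *: v); set q := g _ in gE.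
have tq : table s q by rewrite -gE; apply: fold_table.
have nq : ~ isnode q by rewrite /q (isnode_inW s_gt0 _ hg); apply: nn.
have alt : al t = q by [].
pose w := wl k v.
have nw : enorm w = enorm v by apply/(NC_enorm s_gt0)/NC_wl.
(* near time t the curve follows any image of the line that stays in the table *)
have dep k' g' : inW k' g' -> g' (P + t *: v) = q ->
    (forall j, bar j q = 0 -> 0 <= rate j (wl k' v)) -> departs al t (wl k' v).
  move=> hg' e' hr; have [e e0 he] := table_move tq hr; exists e => // h hh.
  rewrite alt /al scalerDl addrA -e' -wlZ // -(inW_add s_gt0 _ _ hg').
  by apply: (foldE hg'); rewrite (inW_add s_gt0 _ _ hg') wlZ // e'; apply: he.
have arr k' g' : inW k' g' -> g' (P + t *: v) = q ->
    (forall j, bar j q = 0 -> rate j (wl k' v) <= 0) -> arrives al t (wl k' v).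
  move=> hg' e' hr.
  have hr' j : bar j q = 0 -> 0 <= rate j (- wl k' v).
    by move=> /hr; rewrite rateN // oppr_ge0.
  have [e e0 he] := table_move tq hr'; exists e => // h hh.
  have e1 : g' (P + (t - h) *: v) = q + h *: (- wl k' v).
    rewrite (_ : P + _ = P + t *: v + (- h) *: v); last by rewrite -addrA -scalerDl.
    by rewrite (inW_add s_gt0 _ _ hg') wlZ // e' scaleNr scalerN.
  by rewrite alt /al (foldE hg') e1 ?scalerN // -scalerN; apply: he.
split; first by rewrite alt.
  move=> i e; apply: nq; apply/(vertex_isnode s_gt0 tq).
  by exists i; rewrite -alt.
rewrite alt; have [[i hi]|nb] := pselect (boundary s q); last first.
  have nb0 j : bar j q <> 0 by move=> e; apply: nb; exists j; apply/(sideP s_gt0).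
  exists w, w; split=> //.
    by split; [apply: (arr k g) => // j /nb0|apply: (dep k g) => // j /nb0].
  by move=> j hj; case: nb; exists j.
have /(sideP s_gt0)[_ bi] := hi.
have intb j : bar j q = 0 -> isint (rate j q).
  by rewrite barE // => e; exists (- (j == 1)%:Z); rewrite mulrNz -pmulrn; lra.
have only j : bar j q = 0 -> j = i.
  move=> bj; apply/eqP/negPn/negP => ji.
  exact: nq (isnode_rates ji (intb _ bj) (intb _ bi)).
have [k1 [g1 [_ hg1 fix1 lin1]]] := side_reflection s_gt0 i.
have [k2 [_ lin2 hg2]] := inW_comp s_gt0 hg1 hg.
have g2q : (g1 \o g) (P + t *: v) = q by rewrite /= -/q fix1.
have w2 : wl k2 v = mirror (side_dir s i) w by rewrite lin2 lin1.
have nw2 : enorm (wl k2 v) = enorm v by apply/(NC_enorm s_gt0)/NC_wl.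
have rw2 : rate i (wl k2 v) = - rate i w.
  by rewrite w2 rate_mirror // eqxx; ring.
have wi : rate i w != 0.
  have [j [hj hij]] := inW_rate s_gt0 i hg; rewrite /w hj mulf_neq0 //.
    by case: odd_weyl; rewrite ?oppr_eq0 oner_eq0.
  by apply: (tv t); apply/hij/intb.
have sd j : side s j q -> j = i by case/(sideP s_gt0) => _; apply: only.
case: (ltrgtP (rate i w) 0) wi => // wi _.
- exists w, (wl k2 v); split=> //.
  + split; [apply: (arr k g) => // j /only ->; exact: ltW|].
    by apply: (dep k2 _ hg2) => // j /only ->; rewrite rw2 oppr_ge0 ltW.
  + by move=> nb; case: nb; exists i.
  + by move=> j /sd ->.
exists (wl k2 v), w; split=> //.
- split; [|apply: (dep k g) => // j /only ->; exact: ltW].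
  by apply: (arr k2 _ hg2) => // j /only ->; rewrite rw2 oppr_le0 ltW.
- by move=> nb; case: nb; exists i.
- by move=> j /sd ->; rewrite w2 mirrorK.
Qed.

Lemma fold_standard x v : 0 < x < 1 -> in_cone s v ->
  (forall t, ~ isnode (pt x 0 + t *: v)) ->
  standard (fun t => F (pt x 0 + t *: v)) 0 v.
Proof.
move=> /andP[x0 x1] cv nn; have [v1 v2 v3] := cv.
have N0 : 0 < NC v by rewrite NC_half; have := sqr_ge0 (XC v + YC v / 2); nra.
have tP : table s (pt x 0) by apply/(tableE s_gt0); rewrite !coordD; split; lra.
have FP : F (pt x 0) = pt x 0 by rewrite (foldE (inW_id s_gt0)).
split=> //.
- apply: fold_trajectory => // t j; elim/ord3_ind: j; rewrite /side_rate /= !coordD => h.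
  + by rewrite gt_eqF.
  + by rewrite lt_eqF //; lra.
  + apply/eqP => e; move: h; rewrite e mulr0 addr0 => /isint_small.
    by lra.
- by rewrite scale0r addr0 FP; apply/(sideP s_gt0); split=> //; rewrite /barycentric /= !coordD.
have [j b|e e0 he] := @table_move (pt x 0) v tP.
  move: j b; elim/ord3_ind; rewrite /barycentric /side_rate /= !coordD; lra.
exists e => // h hh; rewrite add0r scale0r addr0 FP.
by rewrite (foldE (inW_id s_gt0)) //; apply: he.
Qed.

(** The line starts at abscissa 1 / 2b with b = m + 3n. At a node, both 1 / 2b
    + t m and t b would be integers, and multiplying the first one by 2b gives
    an odd number equal to an even one. *)
Lemma lattice_orbit m n : (0 < m + n)%N -> exists al,
  standard al 0 (lattice_vector s m n) /\
  forall d, (0 < d)%N -> (d %| m)%N -> (d %| n)%N ->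
    forall t, al (t + d%:R^-1) = al t.
Proof.
move=> mn0; pose b := (m + 3 * n)%N.
have b0 : (0 < b)%N by rewrite /b; lia.
have bR : 1 <= b%:R :> R by rewrite ler1n.
pose x : R := (2 * b%:R)^-1; pose v := lattice_vector s m n.
have vX : XC v = m%:R by rewrite !coordD.
have vY : YC v = b%:R by rewrite !coordD.
have bx : b%:R * x = 1 / 2 by rewrite /x; field; lra.
exists (fun t => F (pt x 0 + t *: v)); split.
  apply: fold_standard.
  - rewrite invr_gt0 mulr_gt0 //=; last by lra.
    by rewrite invf_lt1 //; lra.
  - by rewrite /in_cone vX vY ler0n ler_nat ltr0n /b; split=> //; lia.
  move=> t [[i hi] [j hj]]; move: hi hj; rewrite !coordD ?vX ?vY add0r -/b => hi hj.
  have : (1 + 2 * (m%:Z * j))%:~R = (2 * (b%:Z * i))%:~R :> R.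
    rewrite !(intrD, intrM) -!pmulrn -hi -hj.
    have -> : 2 * (b%:R * (x + t * m%:R)) = 2 * (b%:R * x) + 2 * (b%:R * (t * m%:R)) by ring.
    by rewrite bx; field.
  by move/eqP; rewrite eqr_int; clear; lia.
move=> d d0 /dvdnP[m' em] /dvdnP[n' en] t.
have dR : d%:R != 0 :> R by rewrite pnatr_eq0 -lt0n.
rewrite scalerDl addrA.
have -> : d%:R^-1 *: v = tr (m' + 3 * n')%N%:Z (- n'%:Z).
  apply: cinj; rewrite !coordD -/v ?vX ?vY /b ?em ?en ?(natrD, natrM, intrD, intrM, mulrNz, PoszD, PoszM) -?pmulrn;
    field; exact: dR.
set c := tr _ _; have hW : inW WId (fun p => wl WId p + c) by do 2!eexists.
by have := fold_invariant (pt x 0 + t *: v) hW; rewrite wl1.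
Qed.

Lemma standard_orbit al T v : standard al 0 v -> 0 < T -> (forall t, al (t + T) = al t) ->
  vector_class s (T *: v) (TimedCurve al 0 T).
Proof.
move=> st T0 hT; have [tr _ _ _] := st; split.
  by split=> //= t; rewrite add0r addrC hT.
by exists v; [apply: standard_velocity_refl|rewrite /= subr0].
Qed.

End Folding.

(** * Counting the classes *)

Section Counting.
Variables (R : realType) (s : R).
Hypothesis s_gt0 : 0 < s.
Implicit Types (p q u v w z V : 'rV[R]_2) (f g : 'rV[R]_2 -> 'rV[R]_2).
Implicit Types (al : R -> 'rV[R]_2) (o : timed_curve R).

Local Notation XC := (coordX s).
Local Notation YC := (coordY s).
Local Notation pt := (at_coords s).
Local Notation wl := (weyl_act s).
Local Notation tr := (lattice_shift s).
Local Notation inW := (unfolding_elt s).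
Local Notation coordD := (coord_rules s_gt0).
Local Notation cinj := (coord_inj s_gt0).

Local Notation standard := (starts_standard s).

Lemma midpointE : [/\ midpoint s 0 = pt (1 / 2) 0, midpoint s 1 = pt (1 / 2) (1 / 2) &
  midpoint s 2 = pt 0 (1 / 2)].
Proof.
have [v0 v1 v2] := vertexE s; have [[e1 e2 e3] [e4 e5 e6]] := ord3_add.
by split; rewrite /midpoint ?e1 ?e2 ?e3 ?e4 ?e5 ?e6 ?v0 ?v1 ?v2; apply: cinj;
  rewrite !coordD; field.
Qed.

(** The line leaves the middle of BC at 60 degrees. It folds onto the medial
    triangle, whose three sides come from three successive tiles, and it
    repeats after a glide reflection. *)
Lemma fagnano_ex : exists o, fagnano s o.
Proof.
pose v := pt 0 (3 / 2); pose al t := fold_plane s_gt0 (pt (1 / 2) 0 + t *: v).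
have coordv : XC v = 0 /\ YC v = 3 / 2 by rewrite !coordD.
have [vX vY] := coordv.
have st : standard al 0 v.
  apply: fold_standard; first by apply/andP; split; lra.
    by rewrite /in_cone vX vY; split; lra.
  move=> t [] + _; rewrite !coordD mulr0 addr0 => -[m hm].
  have : (2 * m)%:~R = 1%:~R :> R by rewrite intrM -hm; field.
  by move/eqP; rewrite eqr_int; clear; lia.
have hT t : al (t + 1) = al t.
  have hg : inW WRef2 (fun p => wl WRef2 p + tr 1 0) by do 2!eexists.
  rewrite -[RHS](fold_invariant _ _ hg); congr fold_plane.
  by apply: cinj; rewrite !coordD /= ?coordD ?vX ?vY; field.
have oV : vector_class s v (TimedCurve al 0 1).
  by rewrite -[v]scale1r; apply: standard_orbit => //; exact: ltr01.
have [po _] := oV.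
exists (TimedCurve al 0 1); split=> //.
- split=> //; exists 1; last by rewrite /= subr0 mul1r.
  split=> // T T0 hT'.
  have [[m [n e]]|[_ [j e]]] := standard_holonomy s_gt0 st T0 hT'.
    have eX := congr1 XC e; have eY := congr1 YC e; move: eX eY.
    rewrite !coordD ?vX ?vY mulr0 => /esym/eqP; rewrite pnatr_eq0 => /eqP -> eY.
    have n0 : (0 < n)%N.
      rewrite lt0n; apply/eqP => n0; rewrite n0 muln0 in eY; lra.
    have : 1 <= n%:R :> R by rewrite ler1n.
    by move: eY; rewrite add0n natrM; lra.
  have := congr1 YC e; rewrite !coordD ?vY.
  have : 0 <= j%:R :> R by []. 
  lra.
- case: (vector_class_period s_gt0 oV) => [[m [n [e _]]]|[j [e hp]]].
    by case: (@even_not_odd R s s_gt0 v m n 0 e); rewrite /odd_vector /v mulr0 addr0.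
  have j0 : j = 0%N.
    have := congr1 YC e; rewrite !coordD => h.
    by apply/eqP; rewrite -(pnatr_eq0 R); apply/eqP; lra.
  by move: hp; rewrite j0.
have fe k g p q : inW k g -> g p = q -> table s q -> fold_plane s_gt0 p = q.
  by move=> hg <- tq; apply: foldE hg tq.
have a1 t : 0 <= t <= 1 / 3 -> al t = pt (1 / 2) (3 / 2 * t).
  move=> /andP[t0 t1].
  have e : pt (1 / 2) 0 + t *: v = pt (1 / 2) (3 / 2 * t).
    by apply: cinj; rewrite !coordD ?vX ?vY; ring.
  apply: (fe WId id _ _ _ e); first exact: inW_id.
  by apply/(tableE s_gt0); rewrite !coordD; split; lra.
have a2 t : 1 / 3 <= t <= 2 / 3 -> al t = pt (1 - 3 / 2 * t) (1 / 2).
  move=> /andP[t0 t1]; pose g p := wl WRef1 p + tr 1 0.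
  have e : g (pt (1 / 2) 0 + t *: v) = pt (1 - 3 / 2 * t) (1 / 2).
    by apply: cinj; rewrite !coordD /= ?coordD ?vX ?vY; field.
  apply: (fe WRef1 g _ _ _ e); first by do 2!eexists.
  by apply/(tableE s_gt0); rewrite !coordD; split; lra.
have a3 t : 2 / 3 <= t <= 1 -> al t = pt (3 / 2 * t - 1) (3 / 2 - 3 / 2 * t).
  move=> /andP[t0 t1]; pose g p := wl WRotV p + tr 2 (-1).
  have e : g (pt (1 / 2) 0 + t *: v) = pt (3 / 2 * t - 1) (3 / 2 - 3 / 2 * t).
    by apply: cinj; rewrite !coordD /= ?coordD ?vX ?vY; field.
  apply: (fe WRotV g _ _ _ e); first by do 2!eexists.
  by apply/(tableE s_gt0); rewrite !coordD; split; lra.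
have [m0 m1 m2] := midpointE; have [[e1 e2 e3] [e4 e5 e6]] := ord3_add.
apply/seteqP; split=> [_ [t /= /andP[t0 t1] <-]|x [i]] /=.
  have [h1|h1] := leP t (1 / 3).
    exists 2; rewrite e5 e6 m0 m1; exists (3 * t); first by apply/andP; split; lra.
    by rewrite a1 ?t0 //; apply: cinj; rewrite !coordD; field.
  have [h2|h2] := leP t (2 / 3).
    exists 0; rewrite e1 e2 m2 m1; exists (3 * t - 1); first by apply/andP; split; lra.
    by rewrite a2 ?h2 ?(ltW h1) //; apply: cinj; rewrite !coordD; field.
  exists 1; rewrite e3 e4 m2 m0; exists (3 * t - 2); first by apply/andP; split; lra.
  by rewrite a3 ?t1 ?(ltW h2) //; apply: cinj; rewrite !coordD; field.
elim/ord3_ind: i; rewrite ?e1 ?e2 ?e3 ?e4 ?e5 ?e6 ?m0 ?m1 ?m2 => -[k /andP[k0 k1] ->].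
- exists ((1 + k) / 3); first by apply/andP; split; lra.
  by rewrite a2; [apply: cinj; rewrite !coordD; field|apply/andP; split; lra].
- exists ((2 + k) / 3); first by apply/andP; split; lra.
  by rewrite a3; [apply: cinj; rewrite !coordD; field|apply/andP; split; lra].
- exists (k / 3); first by apply/andP; split; lra.
  by rewrite a1; [apply: cinj; rewrite !coordD; field|apply/andP; split; lra].
Qed.

Lemma lattice_class_orbit m n : (0 < m + n)%N -> exists o,
  vector_class s (lattice_vector s m n) o /\
  forall d, (0 < d)%N -> (d %| m)%N -> (d %| n)%N ->
    stop o - start o = 1 /\ forall t, curve o (t + d%:R^-1) = curve o t.
Proof.
move=> mn0; have [al [st hT]] := lattice_orbit s_gt0 mn0.
exists (TimedCurve al 0 1); split; last by move=> d d0 dm dn; rewrite /= subr0; split=> //; exact: hT.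
rewrite -[lattice_vector _ _ _]scale1r; apply: (standard_orbit st ltr01).
by move=> t; have := hT 1%N isT (dvd1n _) (dvd1n _) t; rewrite invr1.
Qed.

(** Indexed by k alone, as n = 2a + 3k determines a. *)
Definition rep_class n k := vector_class s (lattice_vector s (n - 3 * k)./2 k).

Lemma rep_class_inj n k k' : (0 < n)%N -> rep23 n k -> rep_class n k = rep_class n k' ->
  k = k'.
Proof.
move=> n0 /rep23P[a e] ek.
have [|o [oV _]] := @lattice_class_orbit (n - 3 * k)./2 k; first by lia.
have oV' : rep_class n k' o by rewrite -ek.
have h := vector_class_uniq s_gt0 oV oV'.
by have [] := even_vector_inj s_gt0 (erefl : even_vector s _ _ _) (h : even_vector s _ _ _).
Qed.

(** The period is determined by the displacement vector, and glide reflections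
    give odd periods. *)
Lemma orbit_classesE n : (0 < n)%N ->
  orbit_classes s (2 * n) = rep_class n @` [set k | rep23 n k].
Proof.
move=> n0; apply/seteqP; split=> [K [[ o po ->] hK]|_ [k kn <-]].
  have [V oV] := vector_class_ex s_gt0 po.
  rewrite (class_ofE s_gt0 oV) in hK *; have hp := hK _ oV.
  case: (vector_class_period s_gt0 oV) => [[m [c [e hp']]]|[j [e hp']]].
    have en := has_period_uniq hp hp'.
    have en' : n = (2 * m + 3 * c)%N by move: en; clear; lia.
    exists c; first by apply/rep23P; exists m.
    rewrite /rep_class e (_ : _./2 = m) //; rewrite en'; clear; lia.
  by have := has_period_uniq hp hp'; clear; lia.
have /rep23P[a e] := kn; have ea : ((n - 3 * k)./2 = a)%N by rewrite e; clear; lia.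
have [|o [oV _]] := @lattice_class_orbit (n - 3 * k)./2 k.
  by rewrite ea; move: e n0; clear; lia.
split; first by exists o; [have [] := oV|rewrite (class_ofE s_gt0 oV)].
by move=> o' /(vector_class_even s_gt0); rewrite ea -e.
Qed.

(** If d > 1 divides both a and k, the folded lattice line is an orbit of the
    class that retraces its path at least d times. Coprime pairs with a > 0
    have only primitive orbits; the remaining coprime pair (0, 1) is the class
    of the double of the Fagnano orbit. *)
Lemma primitive_orbit_classesE n : (0 < n)%N ->
  primitive_orbit_classes s (2 * n) =
  rep_class n @` [set k | rep23 n k /\ coprime (n - 3 * k)./2 k].
Proof.
move=> n0; apply/seteqP; split=> [K []|_ [k [kn ck] <-]].
  rewrite orbit_classesE // => -[k kn <-] pK; exists k => //; split=> //.
  have /rep23P[a e] := kn; have ea : ((n - 3 * k)./2 = a)%N by rewrite e; clear; lia.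
  case: pK => [[ o fo eK]|prim].
    have oV := fagnano_vector s_gt0 fo.
    have : rep_class n k (iterate o 2) by rewrite eK (class_ofE s_gt0 oV).
    move=> /(vector_class_uniq s_gt0 oV) h.
    have [-> ->] := even_vector_inj s_gt0 (h : even_vector s _ _ _) (erefl : even_vector s _ _ _).
    exact: coprimen1.
  have ak0 : (0 < (n - 3 * k)./2 + k)%N by rewrite ea; move: e n0; clear; lia.
  have [ o [oV hd]] := lattice_class_orbit ak0.
  have [_ [T [T0 _ Tmin] eT]] := prim _ oV.
  set d := gcdn (n - 3 * k)./2 k; have d0 : (0 < d)%N by rewrite gcdn_gt0 -addn_gt0.
  have [du /Tmin] := hd d d0 (dvdn_gcdl _ _) (dvdn_gcdr _ _).
  rewrite invr_gt0 ltr0n d0 => /(_ isT).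
  rewrite -[T]mul1r -eT du -[leRHS]mul1r ler_pdivlMr ?ltr0n // mul1r.
  by rewrite lern1 => d1; rewrite /coprime eqn_leq -/d d1.
split; first by rewrite orbit_classesE //; exists k.
have /rep23P[a e] := kn; have ea : ((n - 3 * k)./2 = a)%N by rewrite e; clear; lia.
case: (posnP (n - 3 * k)./2) => [a0|a0]; last first.
  by right=> o; exact: coprime_primitive a0 ck.
move: ck; rewrite /rep_class a0 /coprime gcd0n => /eqP ->; left.
have [ o fo] := fagnano_ex; exists o => //.
by rewrite (class_ofE s_gt0 (fagnano_vector s_gt0 fo)).
Qed.

Lemma rep_class_card n (q : seq nat) (A : set nat) : (0 < n)%N -> uniq q ->
  (forall k, k \in q <-> A k) -> (forall k, A k -> rep23 n k) ->
  has_card (rep_class n @` A) (size q)%:Z.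
Proof.
move=> n0 uq qA An; exists (size q) => //.
apply: card_eq_trans (seq_card_eq uq erefl qA).
apply: inj_card_eq => k k'; rewrite !inE => /An kn _; exact: rep_class_inj.
Qed.

End Counting.

Theorem theorem6 (R : realType) (s : R) (s_gt0 : 0 < s) (n : nat)
    (n_gt0 : (0 < n)%N) :
  has_card (primitive_orbit_classes s (2 * n)%N) (num_primitive_classes n) /\
  has_card (orbit_classes s (2 * n)%N) (num_classes n).
Proof.
rewrite primitive_orbit_classesE // orbit_classesE //.
rewrite -size_reps23 -size_prim_reps23 //; split.
  apply: rep_class_card => // [|k|k []//]; first by rewrite filter_uniq // reps23_uniq.
  by rewrite mem_filter mem_reps23; split=> [/andP[]|[-> ->]].
by apply: rep_class_card => // [|k]; rewrite ?reps23_uniq ?mem_reps23.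
Qed.
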